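(* Consider the observation model $$z_k=\gamma_kh_k(x_k)+v_k,\qquad v_k=D_{k-1}v_{k-1}+u_{k-1},\qquad y_k=(1-\lambda_k)z_k+\lambda_kw_k,\qquad k\ge1,$$ where the processes involved satisfy hypotheses (H1)–(H8) listed in the context, and where the least-squares (LS) linear estimation of the signal $x_k$ from the available observations $y_k$ is based on the linear approximation $z_k=\gamma_k(H_kx_k+C_k)+v_k$ of the measurements described in the context. Then, with $\Gamma^a_k,\Delta^a_k$ ($a=x,v$) as in the context, the innovation $\eta_k$ is calculated as $$\eta_k=y_k-(1-\overline{\lambda}_k)\big(\Delta^{x}_ke^{x}_{k-1}+\Delta^{v}_ke^{v}_{k-1}+\overline{\gamma}_kC_k\big),\quad k\ge1,$$ and its covariance matrix $\Sigma^\eta_k$ satisfies $$\Sigma^{\eta}_k=\Sigma^{y}_k-(1-\overline{\lambda}_k)^2\Big[\big(\Delta_k^xT_{k-1}^{xx}+\Delta_k^vT_{k-1}^{vx}\big)(\Delta_k^{x})^T+\big(\Delta_k^xT_{k-1}^{xv}+\Delta_k^vT_{k-1}^{vv}\big)(\Delta_k^{v})^T+\overline{\gamma}_k^2C_kC_k^{T}\Big],\quad k\ge1,$$ with $$\Sigma^{y}_k=(1-\overline{\lambda}_k)\Sigma^{z}_{k}+\overline{\lambda}_k\Sigma^{w}_{k},\qquad \Sigma^{z}_{k}=\overline{\gamma}_k\big(H_{k}A_kB^{T}_kH^{T}_{k}+C_kC_k^{T}\big)+E_kF_k^T,\quad k\ge1.$$ The vectors $e^a_k$ ($a=x,v$)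 are recursively obtained by $$e^{a}_k=e^{a}_{k-1}+\Psi^{a}_k(\Sigma^{\eta}_k)^{-1}\eta_k,\quad k\ge1;\qquad e^a_0=0,$$ where $$\Psi^{a}_k=(1-\overline{\lambda}_k)\big(\Gamma_k^a-\Delta^{x}_kT^{xa}_{k-1}-\Delta^{v}_kT^{va}_{k-1}\big)^T,\quad k\ge1.$$ The matrices $T^{ab}_k=\mathbb E[e^a_k(e^b_k)^T]$ ($a,b=x,v$) are also recursively calculated by $$T^{ab}_k=T^{ab}_{k-1}+\Psi^{a}_k(\Sigma^{\eta}_k)^{-1}(\Psi^{b}_k)^T,\quad k\ge1;\qquad T^{ab}_0=0.$$ The filtering estimator of the signal, $\widehat x_{k/k}$, is then computed by $$\widehat{x}_{k/k}=A_ke^{x}_k,\quad k\ge1.$$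
   Context: Notation: $\mathbb E[a]=\overline a$ is the expectation; for a stochastic process $\{a_k\}_{k\ge1}$, $\Sigma^a_{k,s}=Cov[a_k,a_s]=\mathbb E[(a_k-\overline a_k)(a_s-\overline a_s)^T]$ and $\Sigma^a_k=Cov[a_k]$. $M^T$ and $M^{-1}$ denote transpose and inverse. Hypotheses: (H1) The $n_x$-dimensional signal $\{x_k\}_{k\ge1}$ is a second-order zero-mean random process whose covariance function can be factorized as $\Sigma^x_{k,s}=A_kB_s^T$ for $s\le k$, where $A_k,B_s\in\mathbb R^{n_x\times p}$ are known matrices. (H2) $\{\gamma_k\}_{k\ge1}$ is a sequence of independent Bernoulli random variables with known means $\overline\gamma_k$. (H3) For all $k\ge1$, $h_k:\mathbb R^{n_x}\to\mathbb R^{n_z}$ is an analytic function. (H4) $v_0$ is a zero-mean random vector with known covariance $\Sigma^v_0$. The matrices $D_k$ are nonsingular for all $k\ge0$. (H5) $\{u_k\}_{k\ge0}$ is a zero-mean white sequence with known covariances $\Sigma^u_k=Cov[u_k]$, independent of $v_0$. (H6) $\{w_k\}_{k\ge1}$ is a zero-mean white sequence with known covariances $\Sigma^w_k=Cov[w_k]$. (H7) $\{\lambda_k\}_{k\ge1}$ is a sequence of independent Bernoulli random variables with known means $\overline\lambda_k$. (H8) The processes $\{x_k\}_{k\ge1}$, $\{\gamma_k\}_{k\ge1}$, $\{v_k\}_{k\ge1}$, $\{w_k\}_{k\ge1}$, $\{\lambda_k\}_{k\ge1}$ are mutually independent. Noise covariance: with $\Sigma^v_s=D_{s-1}\Sigma^v_{s-1}D_{s-1}^T+\Sigma^u_{s-1}$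 ($s\ge1$), $E_k=D_{k-1}\cdots D_0$ and $F_s=\Sigma^v_s(E_s^{-1})^T$, one has $\Sigma^v_{k,s}=E_kF_s^T$ for $s\le k$. Linearization: assuming knowledge of a nominal trajectory $\{x^0_k\}_{k\ge1}$ of the signal, let $H_k=\frac{\partial h_k(x)}{\partial x}\big|_{x=x^0_k}$ (Jacobian matrix) and $C_k=h_k(x^0_k)-H_kx^0_k$. Neglecting the terms of order greater than one in the Taylor expansion of $h_k$ about $x_k^0$, the measurement equation $z_k=\gamma_kh_k(x_k)+v_k$ is approximated by $z_k=\gamma_k(H_kx_k+C_k)+v_k$, and this approximation is inserted in $y_k=(1-\lambda_k)z_k+\lambda_kw_k$ to obtain the estimators. Estimators and innovations: $\widehat a_{k/s}$ denotes the optimal (LS) linear estimator of $a_k$ based on $\{y_1,\dots,y_s\}$; the filtering estimator is the case $s=k$. The innovation is $\eta_k=y_k-\widehat y_{k/k-1}$, with covariance $\Sigma^\eta_k=Cov[\eta_k]$. The LS linear estimator of a random vector $\zeta_k$ based on $y_1,\dots,y_L$ is expressed through the innovations as $\widehat\zeta_{k/L}=\sum_{j=1}^L\mathbb E[\zeta_k\eta_j^T](\Sigma^\eta_j)^{-1}\eta_j$; the innovation is $\eta_k=y_k-(1-\overline\lambda_k)\widehat z_{k/k-1}$, and under the linear approximation $\widehat z_{k/k-1}$ is approximated by $\overline\gamma_k(H_k\widehat x_{k/k-1}+C_k)+\widehat v_{k/k-1}$. Auxiliary matrices: $\Gamma^x_k=\overline\gamma_kH_kB_k$, $\Gamma^v_k=F_k$,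 $\Delta^x_k=\overline\gamma_kH_kA_k$, $\Delta^v_k=E_k$.
   Formalization: The matrices Σ^y_k and Σ^z_k are taken as the non-centred second moments E[y_k y_k^T] and E[z_k z_k^T], because the displayed formulas fail for covariances when C_k ≠ 0; the innovation covariance Σ^η_k is assumed nonsingular, as its inverse requires. *)

(* Defs.v *)
From HB Require Import structures.
From mathcomp Require Import all_boot all_order all_algebra.
From mathcomp Require Import all_classical all_reals all_analysis.

Set Implicit Arguments.
Unset Strict Implicit.
Unset Printing Implicit Defensive.

Import Order.TTheory GRing.Theory Num.Theory.
Import numFieldNormedType.Exports.

Local Open Scope classical_set_scope.
Local Open Scope ring_scope.

Section Analytic.
Context {R : realType}.

Definition monomial n (al : {ffun 'I_n -> nat}) (x : 'cV[R]_n) : R :=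
  \prod_i x i 0 ^+ al i.

(* Near a, f is the sum of an absolutely convergent multivariate power series
   centred at a; by absolute convergence, the partial sums over the boxes
   {0, ..., N-1}^n suffice to express the value of the sum. *)
Definition analytic_at n (f : 'cV[R]_n -> R) (a : 'cV[R]_n) : Prop :=
  exists c : {ffun 'I_n -> nat} -> R, \forall x \near a,
    summable [set: {ffun 'I_n -> nat}]
      (fun al => (c al * monomial al (x - a))%:E) /\
    (\sum_(be : {ffun 'I_n -> 'I_N})
        (let al := [ffun i => nat_of_ord (be i)] in
         c al * monomial al (x - a))) @[N --> \oo] --> f x.

Definition analytic m n (f : 'cV[R]_m -> 'cV[R]_n) : Prop :=
  forall (i : 'I_n) (a : 'cV[R]_m), analytic_at (fun x => f x i 0) a.

(* The library's jacobian acts on row vectors from the right; transposing gives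
   the usual matrix, with the derivative of f_i along x_j in entry (i, j). *)
Definition jacobian_mx m n (f : 'cV[R]_m -> 'cV[R]_n) (a : 'cV[R]_m)
    : 'M[R]_(n, m) :=
  (jacobian (fun r : 'rV[R]_m => (f r^T)^T) a^T)^T.

End Analytic.

Section RandomVectors.
Context d (T : measurableType d) (R : realType) (P : probability T R).

Definition second_order n (a : T -> 'cV[R]_n) : Prop :=
  forall i, (fun t => a t i 0) \in Lfun P 2%:E.

Definition mean n (a : T -> 'cV[R]_n) : 'cV[R]_n :=
  \col_i fine 'E_P[fun t => a t i 0].

Definition Cov m n (a : T -> 'cV[R]_m) (b : T -> 'cV[R]_n) : 'M[R]_(m, n) :=
  \matrix_(i, j) fine (covariance P (fun t => a t i 0) (fun t => b t j 0)).

(* Non-centred, unlike Cov. *)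
Definition moment2 m n (a : T -> 'cV[R]_m) (b : T -> 'cV[R]_n)
    : 'M[R]_(m, n) :=
  \matrix_(i, j) fine 'E_P[fun t => a t i 0 * b t j 0].

Definition is_bernoulli (X : T -> R) (q : R) : Prop :=
  P (X @^-1` [set 1]) = q%:E /\ P (X @^-1` [set 0]) = (1 - q)%:E.

Definition sigma_rv (X : T -> R) : set_system T :=
  preimage_set_system setT X measurable.

Definition sigma_process (D : set nat) (X : nat -> T -> R) : set_system T :=
  <<s \bigcup_(k in D) sigma_rv (X k) >>.

Definition sigma_vprocess n (D : set nat) (X : nat -> T -> 'cV[R]_n)
    : set_system T :=
  <<s \bigcup_(k in D) \bigcup_(i in [set: 'I_n])
        sigma_rv (fun t => X k t i 0) >>.

Definition mutually_independent (I : eqType) (D : set I)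
    (F : I -> set_system T) : Prop :=
  forall (J : seq I) (A : I -> set T), uniq J ->
    (forall i, i \in J -> D i /\ F i (A i)) ->
    P (\bigcap_(i in [set` J]) A i) = (\prod_(i <- J) P (A i))%E.

(* Whiteness in the second-order sense: uncorrelated, not independent, terms. *)
Definition white_noise n (D : set nat) (X : nat -> T -> 'cV[R]_n)
    (S : nat -> 'M[R]_n) : Prop :=
  [/\ forall k, D k -> second_order (X k),
      forall k, D k -> mean (X k) = 0,
      forall k, D k -> Cov (X k) (X k) = S k
    & forall k s, D k -> D s -> k != s -> Cov (X k) (X s) = 0].

End RandomVectors.

Section LeastSquares.
Context d (T : measurableType d) (R : realType) (P : probability T R).
Variable m : nat.

(* An estimator is a function of the data record (Y_1, Y_2, ...), so that an
   estimator which is optimal for one observation process can be run on the data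
   of another.  "Linear" includes a constant term, which is needed because the
   observations are not assumed to have zero mean. *)
Definition linear_estimator n (s : nat)
    (f : (nat -> 'cV[R]_m) -> 'cV[R]_n) : Prop :=
  exists (c : 'cV[R]_n) (K : nat -> 'M[R]_(n, m)),
    forall Y, f Y = c + \sum_(1 <= j < s.+1) K j *m Y j.

Definition mean_square_error n (zeta f : T -> 'cV[R]_n) : \bar R :=
  'E_P[fun t => \sum_i (zeta t i 0 - f t i 0) ^+ 2].

Definition LS_linear_estimator n (y : nat -> T -> 'cV[R]_m) (s : nat)
    (zeta : T -> 'cV[R]_n) (f : (nat -> 'cV[R]_m) -> 'cV[R]_n) : Prop :=
  linear_estimator s f /\
  forall g, linear_estimator s g ->
    (mean_square_error zeta (fun t => f (y ^~ t)) <=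
     mean_square_error zeta (fun t => g (y ^~ t)))%E.

End LeastSquares.

(* The superscripts x and v; the corresponding vectors e^x and e^v have
   different dimensions, p and nz. *)
Inductive component := Signal | Noise.

Definition cdim (p nz : nat) (a : component) : nat :=
  match a with Signal => p | Noise => nz end.

(* Main.v *)
(* The data y_1, ..., y_s and the innovations up to time s determine each other by
   a triangular affine change of variables, and the innovations are centred and
   mutually orthogonal.  By Pythagoras, a linear estimator whose error is
   orthogonal to the innovations is at zero mean square distance from any optimal
   one; since the innovation covariances are nonsingular, the two then agree as
   functions of the data record, not only almost surely.

   Because Cov[x_k, x_s] = A_k B_s^T and Cov[v_k, v_s] = E_k F_s^T for s <= k, the
   cross moment of y_k with y_j (j < k) is affine in Gamma^x_j, Gamma^v_j with
   coefficients depending on k alone.  Subtracting the predictor of y_j turns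
   Gamma^a_j into Psi^a_j, so the coefficients can be pulled out of the innovation
   expansion; what remains are the vectors e^a, which do not depend on the
   estimated quantity. *)

Require Import Defs.
From HB Require Import structures.
From mathcomp Require Import all_boot all_order all_algebra.
From mathcomp Require Import all_classical all_reals all_analysis.
From mathcomp Require Import measurable_realfun ring.

Set Implicit Arguments.
Unset Strict Implicit.
Unset Printing Implicit Defensive.

Import Order.TTheory GRing.Theory Num.Theory.
Import numFieldNormedType.Exports.

Local Open Scope classical_set_scope.
Local Open Scope ring_scope.

(** * Moments of square-integrable random vectors *)

Section ScalarMoments.
Context d (T : measurableType d) (R : realType) (P : probability T R).
Implicit Types f g : T -> R.

(** The predictor formula at time k+1 rests on the orthogonality of the innovations up to time k,
    while the orthogonality of the next innovation is read off from that formula, so both are proved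
    in one induction. Optimality enters only through uniqueness of the optimal estimator; no normal
    equations are derived from minimality. The observations have mean
    [(1 - lbar k) *: (gbar k *: C k)], so second moments stay non-centred, and orthogonality to the
    innovations always comes with a zero-mean condition, which takes care of the constant term of a
    linear estimator. Beyond square integrability, the recursion uses only the means and cross
    moments of the observations. To compute these, [gam k] and [lam k] are replaced almost surely by
    indicators: every product of variables becomes the indicator of an event times a product of two
    coordinates, and independence is needed only for intersections of events from four
    sigma-algebras. *)

Lemma Lfun2_Lfun1 f : f \in Lfun P 2%:E -> f \in Lfun P 1.
Proof. by move=> hf; apply: (Lfun_subset12 _ hf); apply: fin_num_measure. Qed.

Lemma Lfun2D f g : f \in Lfun P 2%:E -> g \in Lfun P 2%:E ->
  (fun t => f t + g t) \in Lfun P 2%:E.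
Proof.
move=> hf hg; have h : (1 <= 2%:E :> \bar R)%E := lee1n 2.
exact: ((Lfun_addr_closed P h).2 _ _ hf hg).
Qed.

Lemma Lfun2Z a f : f \in Lfun P 2%:E -> (fun t => a * f t) \in Lfun P 2%:E.
Proof.
move=> hf; have h : 1 <= 2 :> R by rewrite ler1n.
have -> : (fun t => a * f t) = a \o* f by apply/funext => t /=; rewrite mulrC.
exact: Lfun_scale.
Qed.

Lemma Lfun2_sum n (f : 'I_n -> T -> R) :
  (forall i, f i \in Lfun P 2%:E) -> (fun t => \sum_i f i t) \in Lfun P 2%:E.
Proof.
move=> hf; have h : (1 <= 2%:E :> \bar R)%E := lee1n 2.
have [h0 hD] := Lfun_addr_closed P h.
have -> : (fun t => \sum_i f i t) = \sum_i f i.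
  by apply/funext => t; rewrite fct_sumE.
by elim/big_ind : _ => // *; apply: hD.
Qed.

Lemma fine_expectationD f g : f \in Lfun P 1 -> g \in Lfun P 1 ->
  fine 'E_P[fun t => f t + g t] = fine 'E_P[f] + fine 'E_P[g].
Proof.
by move=> hf hg; rewrite -fineD ?expectation_fin_num// -expectationD.
Qed.

Lemma fine_expectationZ a f : f \in Lfun P 1 ->
  fine 'E_P[fun t => a * f t] = a * fine 'E_P[f].
Proof.
move=> hf; rewrite -[a in RHS]/(fine a%:E) -fineM ?expectation_fin_num//.
rewrite -expectationZl//; congr (fine 'E_P[_]).
by apply/funext => t /=; rewrite mulrC.
Qed.

Lemma fine_expectation_sum n (f : 'I_n -> T -> R) :
  (forall i, f i \in Lfun P 1) ->
  fine 'E_P[fun t => \sum_i f i t] = \sum_i fine 'E_P[f i].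
Proof.
elim: n f => [|n IH] f hf.
  rewrite big_ord0 (_ : (fun t => _) = cst 0) ?expectation_cst//.
  by apply/funext => t; rewrite big_ord0.
under eq_fun do rewrite big_ord_recl.
rewrite fine_expectationD// ?IH// ?big_ord_recl//.
rewrite (_ : (fun t => _) = \sum_i f (lift ord0 i)); first exact: rpred_sum.
by apply/funext => t; rewrite fct_sumE.
Qed.

Lemma expectation_ae_eq f g :
  measurable_fun setT f -> measurable_fun setT g ->
  (\forall t \ae P, f t = g t) -> ('E_P[f] = 'E_P[g])%E.
Proof.
move=> mf mg fg; rewrite unlock; apply: ae_eq_integral => //.
- exact/measurable_EFinP.
- exact/measurable_EFinP.
- by apply: filterS fg => t /= -> _.
Qed.

Lemma Lfun_measurable q f : f \in Lfun P q -> measurable_fun setT f.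
Proof. by move=> /sub_Lfun_mfun /set_mem. Qed.

Lemma Lfun2_ae_eq f g : measurable_fun setT f -> (\forall t \ae P, f t = g t) ->
  g \in Lfun P 2%:E -> f \in Lfun P 2%:E.
Proof.
move=> mf fg hg; have mg := Lfun_measurable hg.
move/sub_Lfun_finLfun : hg; rewrite inE /= => hg.
apply/andP; split; rewrite inE//=; move: hg; rewrite /finite_norm.
rewrite unlock /Lnorm /=.
rewrite (@ae_eq_integral _ _ _ P setT (fun x => (`|f x| `^ 2)%:E)
  (fun x => (`|g x| `^ 2)%:E))//.
- apply/measurable_EFinP.
  apply: (@measurableT_comp _ _ _ _ _ _ (fun x => x `^ 2)) => //.
  exact: measurableT_comp.
- apply/measurable_EFinP.
  apply: (@measurableT_comp _ _ _ _ _ _ (fun x => x `^ 2)) => //.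
  exact: measurableT_comp.
- by apply: filterS fg => t /= -> _.
Qed.

Lemma expectation_sqr_eq0 f : f \in Lfun P 2%:E ->
  fine 'E_P[fun t => f t * f t] = 0 -> \forall t \ae P, f t = 0.
Proof.
move=> hf.
have h1 := Lfun2_mul_Lfun1 hf hf.
have mf := Lfun_measurable hf.
have mff : measurable_fun setT (fun x => (f x * f x)%:E).
  by apply/measurable_EFinP; apply: measurable_funM.
move=> h0; have : (\int[P]_(x in setT) `|(f x * f x)%:E| = 0)%E.
  rewrite -[RHS](congr1 EFin h0) fineK ?expectation_fin_num// unlock.
  by apply: eq_integral => t _ /=; rewrite ger0_norm// -expr2 sqr_ge0.
move=> /(ae_eq_integral_abs P measurableT mff).
by apply: filterS => t /(_ I) /= [] /eqP; rewrite mulf_eq0 orbb => /eqP.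
Qed.

End ScalarMoments.

(** * Calculus of mean vectors and second-moment matrices *)

Section VectorMoments.
Context d (T : measurableType d) (R : realType) (P : probability T R).

Lemma second_orderD n (X Y : T -> 'cV[R]_n) :
  second_order P X -> second_order P Y -> second_order P (fun t => X t + Y t).
Proof.
move=> hX hY i; under eq_fun do rewrite mxE.
exact: Lfun2D.
Qed.

Lemma second_orderM m n (M : 'M[R]_(m, n)) (X : T -> 'cV[R]_n) :
  second_order P X -> second_order P (fun t => M *m X t).
Proof.
move=> hX i; under eq_fun do rewrite mxE.
by apply: Lfun2_sum => j; apply: Lfun2Z.
Qed.

Lemma second_order_cst n (c : 'cV[R]_n) : second_order P (fun=> c).
Proof. by move=> i; apply: (@Lfun_cst _ _ _ P (c i 0) 2). Qed.

Lemma second_orderZ n a (X : T -> 'cV[R]_n) :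
  second_order P X -> second_order P (fun t => a *: X t).
Proof.
by move=> hX; under eq_fun do rewrite -mul_scalar_mx; apply: second_orderM.
Qed.

Lemma second_orderB n (X Y : T -> 'cV[R]_n) :
  second_order P X -> second_order P Y -> second_order P (fun t => X t - Y t).
Proof.
move=> hX hY; under eq_fun do rewrite -scaleN1r.
exact/second_orderD/second_orderZ.
Qed.

Lemma second_order_sum n (r : seq nat) (q : pred nat) (X : nat -> T -> 'cV[R]_n) :
  (forall j, q j -> second_order P (X j)) ->
  second_order P (fun t => \sum_(j <- r | q j) X j t).
Proof.
move=> hX; elim: r => [|a r IH].
  by under eq_fun do rewrite big_nil; apply: second_order_cst.
under eq_fun do rewrite big_cons.
by case: (boolP (q a)) => // qa; apply: second_orderD => //; apply: hX.
Qed.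

Lemma meanD n (X Y : T -> 'cV[R]_n) : second_order P X -> second_order P Y ->
  mean P (fun t => X t + Y t) = mean P X + mean P Y.
Proof.
move=> hX hY; apply/colP => i; rewrite !mxE; under eq_fun do rewrite mxE.
by rewrite fine_expectationD//; apply: Lfun2_Lfun1.
Qed.

Lemma meanM m n (M : 'M[R]_(m, n)) (X : T -> 'cV[R]_n) : second_order P X ->
  mean P (fun t => M *m X t) = M *m mean P X.
Proof.
move=> hX; apply/colP => i; rewrite !mxE; under eq_fun do rewrite mxE.
rewrite fine_expectation_sum; last first.
  by move=> j; apply/Lfun2_Lfun1/Lfun2Z.
apply: eq_bigr => j _; rewrite mxE fine_expectationZ//.
exact: Lfun2_Lfun1.
Qed.

Lemma mean_cst n (c : 'cV[R]_n) : mean P (fun=> c) = c.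
Proof. by apply/colP => i; rewrite !mxE (expectation_cst P (c i 0)). Qed.

Lemma meanZ n a (X : T -> 'cV[R]_n) : second_order P X ->
  mean P (fun t => a *: X t) = a *: mean P X.
Proof.
move=> hX; under eq_fun do rewrite -mul_scalar_mx.
by rewrite meanM// mul_scalar_mx.
Qed.

Lemma meanB n (X Y : T -> 'cV[R]_n) : second_order P X -> second_order P Y ->
  mean P (fun t => X t - Y t) = mean P X - mean P Y.
Proof.
move=> hX hY; under eq_fun do rewrite -scaleN1r.
by rewrite meanD ?meanZ ?scaleN1r//; apply: second_orderZ.
Qed.

Lemma moment2_tr m n (X : T -> 'cV[R]_m) (Y : T -> 'cV[R]_n) :
  (moment2 P X Y)^T = moment2 P Y X.
Proof.
by apply/matrixP => i j; rewrite !mxE; under eq_fun do rewrite mulrC.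
Qed.

Lemma moment2Dl m n (X Y : T -> 'cV[R]_m) (Z : T -> 'cV[R]_n) :
  second_order P X -> second_order P Y -> second_order P Z ->
  moment2 P (fun t => X t + Y t) Z = moment2 P X Z + moment2 P Y Z.
Proof.
move=> hX hY hZ; apply/matrixP => i j; rewrite !mxE.
under eq_fun do rewrite mxE mulrDl.
by rewrite fine_expectationD//; apply: Lfun2_mul_Lfun1.
Qed.

Lemma moment2Ml m n q (M : 'M[R]_(q, m)) (X : T -> 'cV[R]_m) (Z : T -> 'cV[R]_n) :
  second_order P X -> second_order P Z ->
  moment2 P (fun t => M *m X t) Z = M *m moment2 P X Z.
Proof.
move=> hX hZ; apply/matrixP => i j; rewrite !mxE.
under eq_fun do rewrite mxE mulr_suml.
rewrite fine_expectation_sum; last first.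
  by move=> l; apply: Lfun2_mul_Lfun1 => //; apply: Lfun2Z.
apply: eq_bigr => l _; rewrite mxE; under eq_fun do rewrite -mulrA.
by rewrite fine_expectationZ//; apply: Lfun2_mul_Lfun1.
Qed.

Lemma moment2Zl m n a (X : T -> 'cV[R]_m) (Z : T -> 'cV[R]_n) :
  second_order P X -> second_order P Z ->
  moment2 P (fun t => a *: X t) Z = a *: moment2 P X Z.
Proof.
move=> hX hZ; under eq_fun do rewrite -mul_scalar_mx.
by rewrite moment2Ml// mul_scalar_mx.
Qed.

Lemma moment2Bl m n (X Y : T -> 'cV[R]_m) (Z : T -> 'cV[R]_n) :
  second_order P X -> second_order P Y -> second_order P Z ->
  moment2 P (fun t => X t - Y t) Z = moment2 P X Z - moment2 P Y Z.
Proof.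
move=> hX hY hZ; under eq_fun do rewrite -scaleN1r.
by rewrite moment2Dl ?moment2Zl ?scaleN1r//; apply: second_orderZ.
Qed.

Lemma moment2_cstl m n (c : 'cV[R]_m) (Z : T -> 'cV[R]_n) : second_order P Z ->
  moment2 P (fun=> c) Z = c *m (mean P Z)^T.
Proof.
move=> hZ; apply/matrixP => i j; rewrite !mxE big_ord1 !mxE.
by rewrite fine_expectationZ//; apply: Lfun2_Lfun1.
Qed.

Lemma moment2Dr m n (X Y : T -> 'cV[R]_m) (Z : T -> 'cV[R]_n) :
  second_order P X -> second_order P Y -> second_order P Z ->
  moment2 P Z (fun t => X t + Y t) = moment2 P Z X + moment2 P Z Y.
Proof.
by move=> *; rewrite -moment2_tr moment2Dl// linearD /= !moment2_tr.
Qed.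

Lemma moment2Mr m n q (M : 'M[R]_(q, m)) (X : T -> 'cV[R]_m) (Z : T -> 'cV[R]_n) :
  second_order P X -> second_order P Z ->
  moment2 P Z (fun t => M *m X t) = moment2 P Z X *m M^T.
Proof. by move=> *; rewrite -moment2_tr moment2Ml// trmx_mul moment2_tr. Qed.

Lemma moment2Zr m n a (X : T -> 'cV[R]_m) (Z : T -> 'cV[R]_n) :
  second_order P X -> second_order P Z ->
  moment2 P Z (fun t => a *: X t) = a *: moment2 P Z X.
Proof. by move=> *; rewrite -moment2_tr moment2Zl// linearZ /= moment2_tr. Qed.

Lemma moment2Br m n (X Y : T -> 'cV[R]_m) (Z : T -> 'cV[R]_n) :
  second_order P X -> second_order P Y -> second_order P Z ->
  moment2 P Z (fun t => X t - Y t) = moment2 P Z X - moment2 P Z Y.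
Proof.
by move=> *; rewrite -moment2_tr moment2Bl// linearB /= !moment2_tr.
Qed.

Lemma moment2_cstr m n (c : 'cV[R]_m) (Z : T -> 'cV[R]_n) : second_order P Z ->
  moment2 P Z (fun=> c) = mean P Z *m c^T.
Proof. by move=> *; rewrite -moment2_tr moment2_cstl// trmx_mul trmxK. Qed.

Lemma Cov_tr m n (X : T -> 'cV[R]_m) (Y : T -> 'cV[R]_n) :
  (Cov P X Y)^T = Cov P Y X.
Proof. by apply/matrixP => i j; rewrite !mxE covarianceC. Qed.

Lemma Cov_zero_mean m n (X : T -> 'cV[R]_m) (Y : T -> 'cV[R]_n) :
  mean P X = 0 -> mean P Y = 0 -> Cov P X Y = moment2 P X Y.
Proof.
move=> X0 Y0; apply/matrixP => i j; rewrite !mxE unlock.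
have := congr1 (fun M : 'cV_m => M i 0) X0; rewrite !mxE => ->.
have := congr1 (fun M : 'cV_n => M j 0) Y0; rewrite !mxE => ->.
by congr (fine 'E_P[_]); apply/funext => t; rewrite !fctE /= !subr0.
Qed.

(** Square integrability makes the extended-real error finite, so minimality can be analysed with
    the bilinear calculus of [moment2]. *)
Lemma mean_square_error_trace n (X f : T -> 'cV[R]_n) :
  second_order P X -> second_order P f ->
  mean_square_error P X f =
  (\tr (moment2 P (fun t => X t - f t) (fun t => X t - f t)))%:E.
Proof.
move=> hX hf; have hB := second_orderB hX hf.
have hi i : (fun t => (X t i 0 - f t i 0) ^+ 2) \in Lfun P 1.
  rewrite (_ : (fun t => _) =
    (fun t => (X t - f t) i 0) \* (fun t => (X t - f t) i 0)).
    exact: Lfun2_mul_Lfun1.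
  by apply/funext => t /=; rewrite !mxE expr2.
rewrite /mean_square_error -[LHS]fineK; last first.
  apply: expectation_fin_num.
  rewrite (_ : (fun t => _) = \sum_i (fun t => (X t i 0 - f t i 0) ^+ 2)).
    exact: rpred_sum.
  by apply/funext => t; rewrite fct_sumE.
rewrite fine_expectation_sum//; congr EFin; apply: eq_bigr => i _.
by rewrite mxE; congr (fine 'E_P[_]); apply/funext => t; rewrite !mxE expr2.
Qed.

Lemma moment2_diag_ge0 n (X : T -> 'cV[R]_n) i : 0 <= moment2 P X X i i.
Proof.
by rewrite mxE fine_ge0// expectation_ge0// => t; rewrite -expr2 sqr_ge0.
Qed.

(** The trace is a sum of nonnegative second moments, so each coordinate of [X] vanishes almost
    surely. The upper bound on the trace is the form in which optimality delivers this. *)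
Lemma moment2_trace_le0 m n (X : T -> 'cV[R]_m) (Y : T -> 'cV[R]_n) :
  second_order P X -> second_order P Y -> \tr (moment2 P X X) <= 0 ->
  moment2 P X Y = 0.
Proof.
move=> hX hY tr0; apply/matrixP => i j; rewrite mxE [RHS]mxE.
have /expectation_sqr_eq0 : fine 'E_P[fun t => X t i 0 * X t i 0] = 0.
  have : \tr (moment2 P X X) = 0.
    apply/eqP; rewrite eq_le tr0 sumr_ge0// => l _; exact: moment2_diag_ge0.
  move=> /eqP; rewrite psumr_eq0; last by move=> l _; exact: moment2_diag_ge0.
  by move=> /allP /(_ i (mem_index_enum _)) /=; rewrite mxE => /eqP.
move=> /(_ (hX i)) Xi0.
rewrite (@expectation_ae_eq _ _ _ P _ (cst 0)) ?expectation_cst//.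
- by apply: measurable_funM; [exact: Lfun_measurable (hX i)
                             |exact: Lfun_measurable (hY j)].
- by apply: filterS Xi0 => t ->; rewrite mul0r.
Qed.

Lemma pythagoras_trace n (X Y : T -> 'cV[R]_n) :
  second_order P X -> second_order P Y -> moment2 P X Y = 0 ->
  \tr (moment2 P (fun t => X t - Y t) (fun t => X t - Y t)) =
  \tr (moment2 P X X) + \tr (moment2 P Y Y).
Proof.
move=> hX hY XY0; rewrite moment2Bl//; last exact: second_orderB.
rewrite !moment2Br// XY0 -[moment2 P Y X]moment2_tr XY0 trmx0.
by rewrite subr0 sub0r opprK mxtraceD.
Qed.

End VectorMoments.

(** * Linear estimators and innovations *)

Section LinearEstimators.
Context (R : realType) (m : nat).

Lemma linear_estimatorD n s (f g : (nat -> 'cV[R]_m) -> 'cV[R]_n) :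
  linear_estimator s f -> linear_estimator s g ->
  linear_estimator s (fun Y => f Y + g Y).
Proof.
move=> [c [K hf]] [c' [K' hg]]; exists (c + c'), (fun j => K j + K' j) => Y.
rewrite hf hg addrACA -big_split; congr (_ + _).
by apply: eq_bigr => j _; rewrite mulmxDl.
Qed.

Lemma linear_estimatorM n q s (M : 'M[R]_(q, n))
    (f : (nat -> 'cV[R]_m) -> 'cV[R]_n) :
  linear_estimator s f -> linear_estimator s (fun Y => M *m f Y).
Proof.
move=> [c [K hf]]; exists (M *m c), (fun j => M *m K j) => Y.
rewrite hf mulmxDr mulmx_sumr; congr (_ + _).
by apply: eq_bigr => j _; rewrite mulmxA.
Qed.

Lemma linear_estimator_cst n s (c : 'cV[R]_n) :
  linear_estimator s (fun _ : nat -> 'cV[R]_m => c).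
Proof.
by exists c, (fun=> 0) => Y; rewrite big1 ?addr0// => j _; rewrite mul0mx.
Qed.

Lemma linear_estimatorZ n s a (f : (nat -> 'cV[R]_m) -> 'cV[R]_n) :
  linear_estimator s f -> linear_estimator s (fun Y => a *: f Y).
Proof.
move=> /(linear_estimatorM a%:M); congr (linear_estimator _ _).
by apply/funext => Y; rewrite mul_scalar_mx.
Qed.

Lemma linear_estimatorB n s (f g : (nat -> 'cV[R]_m) -> 'cV[R]_n) :
  linear_estimator s f -> linear_estimator s g ->
  linear_estimator s (fun Y => f Y - g Y).
Proof.
move=> hf /(linear_estimatorZ (-1)) hg; have := linear_estimatorD hf hg.
by congr (linear_estimator _ _); apply/funext => Y; rewrite scaleN1r.
Qed.

Lemma linear_estimatorW n r s (f : (nat -> 'cV[R]_m) -> 'cV[R]_n) : (r <= s)%N ->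
  linear_estimator r f -> linear_estimator s f.
Proof.
move=> rs [c [K hf]]; exists c, (fun j => if (j < r.+1)%N then K j else 0) => Y.
rewrite hf (big_cat_nat (n := r.+1) (p := s.+1))//=; congr (_ + _).
rewrite [X in _ = _ + X]big1_seq ?addr0; last first.
  by move=> j; rewrite mem_index_iota => /andP[_ /andP[rj _]]; rewrite ltnNge rj mul0mx.
by rewrite big_nat [RHS]big_nat; apply: eq_bigr => j /andP[_ ->].
Qed.

Lemma linear_estimator_proj s j : (1 <= j)%N -> (j <= s)%N ->
  linear_estimator s (fun Y : nat -> 'cV[R]_m => Y j).
Proof.
move=> j1 js; apply: linear_estimatorW js _.
exists 0, (fun i => if i == j then 1%:M else 0) => Y.
rewrite add0r big_nat_recr//= eqxx mul1mx big_nat big1 ?add0r//.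
by move=> i /andP[_ ij]; rewrite ltn_eqF// mul0mx.
Qed.

Lemma linear_estimator_sum n s (f : nat -> (nat -> 'cV[R]_m) -> 'cV[R]_n) :
  (forall j, (1 <= j <= s)%N -> linear_estimator s (f j)) ->
  linear_estimator s (fun Y => \sum_(1 <= j < s.+1) f j Y).
Proof.
move=> hf.
suff H l : (l <= s)%N -> linear_estimator s (fun Y => \sum_(1 <= j < l.+1) f j Y).
  exact: H.
elim: l => [_|l IH ls].
  by under eq_fun do rewrite big_geq//; apply: linear_estimator_cst.
under eq_fun do rewrite big_nat_recr//.
by apply: linear_estimatorD; [apply: IH; apply: ltnW|apply: hf].
Qed.

End LinearEstimators.

(** * Innovations as coordinates for linear estimators *)

Section Innovations.
Context d (Om : measurableType d) (R : realType) (P : probability Om R) (m : nat).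
Variable y : nat -> Om -> 'cV[R]_m.
Variables yhat eta : nat -> (nat -> 'cV[R]_m) -> 'cV[R]_m.
Variable S : nat -> 'M[R]_m.
Hypothesis y_second_order : forall k, (1 <= k)%N -> second_order P (y k).
Hypothesis yhat_linear : forall k, (1 <= k)%N -> linear_estimator k.-1 (yhat k).
Hypothesis eta_eq : forall k Y, (1 <= k)%N -> eta k Y = Y k - yhat k Y.
Hypothesis S_unit : forall k, (1 <= k)%N -> S k \in unitmx.

Local Notation etay j := (fun t => eta j (y ^~ t)).

Lemma second_order_estimator n s (f : (nat -> 'cV[R]_m) -> 'cV[R]_n) :
  linear_estimator s f -> second_order P (fun t => f (y ^~ t)).
Proof.
move=> [c [K hf]]; under eq_fun do rewrite hf big_nat.
apply: second_orderD; first exact: second_order_cst.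
by apply: second_order_sum => j /andP[j1 _]; apply/second_orderM/y_second_order.
Qed.

Lemma innovation_linear k : (1 <= k)%N -> linear_estimator k (eta k).
Proof.
move=> k1; rewrite (_ : eta k = fun Y => Y k - yhat k Y); last first.
  by apply/funext => Y; rewrite eta_eq.
apply: linear_estimatorB; first exact: linear_estimator_proj.
by apply: linear_estimatorW (yhat_linear k1); apply: leq_pred.
Qed.

Lemma second_order_innovation k : (1 <= k)%N -> second_order P (etay k).
Proof. by move=> /innovation_linear; apply: second_order_estimator. Qed.

(* The data up to time s are, up to a triangular change of variables, the
   innovations up to time s. *)
Lemma linear_estimator_innovation n s (f : (nat -> 'cV[R]_m) -> 'cV[R]_n) :
  linear_estimator s.+1 f ->
  exists g (K : 'M[R]_(n, m)), linear_estimator s g /\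
    forall Y, f Y = g Y + K *m eta s.+1 Y.
Proof.
move=> [c [K hf]].
exists (fun Y => c + \sum_(1 <= j < s.+1) K j *m Y j + K s.+1 *m yhat s.+1 Y).
exists (K s.+1); split.
  apply: linear_estimatorD; last exact/linear_estimatorM/(yhat_linear (k := s.+1)).
  by exists c, K.
move=> Y; rewrite hf big_nat_recr//= eta_eq// mulmxBr -!addrA.
by congr (_ + (_ + _)); rewrite addrC subrK.
Qed.

(** Peeling off the last innovation reduces the estimator to its constant term, which is annihilated
    by the zero mean of [X]. *)
Lemma moment2_estimator n q s (X : Om -> 'cV[R]_n)
    (f : (nat -> 'cV[R]_m) -> 'cV[R]_q) :
  second_order P X -> mean P X = 0 ->
  (forall j, (1 <= j <= s)%N -> moment2 P X (etay j) = 0) ->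
  linear_estimator s f -> moment2 P X (fun t => f (y ^~ t)) = 0.
Proof.
move=> hX X0; elim: s f => [|s IH] f hXe.
  move=> [c [K hf]]; under [X in moment2 _ _ X]eq_fun do rewrite hf big_geq// addr0.
  by rewrite moment2_cstr// X0 mul0mx.
move=> /linear_estimator_innovation[g [K [hg fE]]].
under [X in moment2 _ _ X]eq_fun do rewrite fE.
have hgs := second_order_estimator hg.
have hes := @second_order_innovation s.+1 isT.
rewrite moment2Dr ?moment2Mr//; last exact: second_orderM.
rewrite hXe ?ltnSn// mul0mx addr0 IH// => j /andP[j1 js].
by rewrite hXe// j1 ltnW.
Qed.

(** Truncated at time [s] because it is established inductively. The zero mean is part of the
    property: it turns the covariance [S j] into a non-centred moment. *)
Definition orthogonal_innovations s := forall j, (1 <= j <= s)%N ->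
  [/\ mean P (etay j) = 0, moment2 P (etay j) (etay j) = S j &
      forall i, (1 <= i < j)%N -> moment2 P (etay j) (etay i) = 0].

Lemma orthogonal_innovationsW r s : (r <= s)%N ->
  orthogonal_innovations s -> orthogonal_innovations r.
Proof. by move=> rs h j /andP[j1 jr]; apply: h; rewrite j1 (leq_trans jr). Qed.

(** Vanishing moments against every [Z] say that the estimator is almost surely zero on the data
    [y]. Testing against the last innovation isolates [K *m S s.+1], and invertibility gives
    [K = 0]; at [s = 0] a constant test vector kills the constant term. All coefficients being zero,
    the conclusion holds for every record [Y], not only for paths of [y]. *)
Lemma estimator_eq0 n s (f : (nat -> 'cV[R]_m) -> 'cV[R]_n) :
  orthogonal_innovations s -> linear_estimator s f ->
  (forall q (Z : Om -> 'cV[R]_q), second_order P Z ->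
     moment2 P (fun t => f (y ^~ t)) Z = 0) ->
  forall Y, f Y = 0.
Proof.
elim: s f => [|s IH] f hS.
  move=> [c [K hf]] f0 Y; have fc Y' : f Y' = c by rewrite hf big_geq// addr0.
  have := f0 _ (fun=> (1 : 'cV_1)) (second_order_cst P 1).
  under [X in moment2 _ X _]eq_fun do rewrite fc.
  rewrite moment2_cstl ?mean_cst; last exact: second_order_cst.
  by rewrite trmx1 mulmx1 fc.
move=> /linear_estimator_innovation[g [K [hg fE]]] f0.
have hgs := second_order_estimator hg.
have hes := @second_order_innovation s.+1 isT.
have [e0 eS ei] := hS s.+1 (ltnSn _).
have K0 : K = 0.
  have := f0 _ _ hes; under [X in moment2 _ X _]eq_fun do rewrite fE.
  rewrite moment2Dl//; last exact: second_orderM.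
  rewrite moment2Ml// eS -[moment2 _ _ _]moment2_tr.
  rewrite (moment2_estimator hes e0 _ hg); last first.
    by move=> j /andP[j1 js]; apply: ei; rewrite j1.
  rewrite trmx0 add0r => /(congr1 (mulmx^~ (invmx (S s.+1)))).
  by rewrite mulmxK ?S_unit// mul0mx.
have fg : f = g by apply/funext => Y; rewrite fE K0 mul0mx addr0.
by rewrite fg in f0 *; apply: IH => //; apply: orthogonal_innovationsW hS.
Qed.

(* Pythagoras: an optimal estimator is at distance zero in mean square from any
   linear estimator whose error is orthogonal to the innovations. *)
Lemma LS_linear_estimator_unique n s (X : Om -> 'cV[R]_n)
    (f g : (nat -> 'cV[R]_m) -> 'cV[R]_n) :
  orthogonal_innovations s -> second_order P X ->
  LS_linear_estimator P y s X f -> linear_estimator s g ->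
  mean P (fun t => X t - g (y ^~ t)) = 0 ->
  (forall j, (1 <= j <= s)%N ->
     moment2 P (fun t => X t - g (y ^~ t)) (etay j) = 0) ->
  forall Y, f Y = g Y.
Proof.
move=> hS hX [hf fmin] hg Xg0 Xge Y; apply/eqP; rewrite -subr_eq0; apply/eqP.
have hd := linear_estimatorB hf hg.
move: Y; apply: (estimator_eq0 hS hd) => q Z hZ.
have hds := second_order_estimator hd; have hfs := second_order_estimator hf.
have hgs := second_order_estimator hg; have hr := second_orderB hX hgs.
apply: moment2_trace_le0 => //.
have rd := moment2_estimator hr Xg0 Xge hd.
have := fmin _ hg; rewrite !mean_square_error_trace// lee_fin.
have -> : (fun t => X t - f (y ^~ t)) =
    (fun t => (X t - g (y ^~ t)) - (f (y ^~ t) - g (y ^~ t))).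
  by apply/funext => t; rewrite opprB addrA subrK.
by rewrite pythagoras_trace// gerDl.
Qed.

End Innovations.

(** * The recursive algorithm *)

Section Recursion.
Context d (Om : measurableType d) (R : realType) (P : probability Om R).
Context (nz p : nat).
Variable y : nat -> Om -> 'cV[R]_nz.
Variables yhat eta : nat -> (nat -> 'cV[R]_nz) -> 'cV[R]_nz.
Variable S : nat -> 'M[R]_nz.
Variable L : nat -> R.
Variable mu : nat -> 'cV[R]_nz.
Variables Gam Del : forall a : component, nat -> 'M[R]_(nz, cdim p nz a).

Hypothesis y_second_order : forall k, (1 <= k)%N -> second_order P (y k).
Hypothesis y_mean : forall k, (1 <= k)%N -> mean P (y k) = L k *: mu k.
(** Separability of the cross moments, with a mean term because they are not centred. The grouping
    makes it the instance [X = y k], [U a = L k *: Del a k], [c = L k *: mu k] of the hypothesis on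
    the estimated vector used further down. *)
Hypothesis y_moment : forall k j, (1 <= j < k)%N ->
  moment2 P (y k) (y j) = L j *: (L k *: Del Signal k *m (Gam Signal j)^T
    + L k *: Del Noise k *m (Gam Noise j)^T + (L k *: mu k) *m (mu j)^T).
Hypothesis yhat_LS : forall k, (1 <= k)%N ->
  LS_linear_estimator P y k.-1 (y k) (yhat k).
Hypothesis eta_eq : forall k Y, (1 <= k)%N -> eta k Y = Y k - yhat k Y.
Hypothesis S_Cov : forall k, (1 <= k)%N ->
  S k = Cov P (fun t => eta k (y ^~ t)) (fun t => eta k (y ^~ t)).
Hypothesis S_unit : forall k, (1 <= k)%N -> S k \in unitmx.

Local Notation etay j := (fun t => eta j (y ^~ t)).

(* Psi_k and T_k are defined by mutual recursion in the theorem; taking the gain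
   as a function of T_{k-1} makes the recursion structural in T alone. *)
Definition gain (T : forall a b : component, 'M[R]_(cdim p nz a, cdim p nz b)) k
    (a : component) : 'M[R]_(cdim p nz a, nz) :=
  L k *: (Gam a k - Del Signal k *m T Signal a - Del Noise k *m T Noise a)^T.

Fixpoint Tcov k : forall a b : component, 'M[R]_(cdim p nz a, cdim p nz b) :=
  match k with
  | 0%N => fun _ _ => 0
  | k'.+1 => fun a b => Tcov k' a b +
      gain (Tcov k') k a *m invmx (S k) *m (gain (Tcov k') k b)^T
  end.

Definition Psi (a : component) k : 'M[R]_(cdim p nz a, nz) :=
  gain (Tcov k.-1) k a.

Definition evec (a : component) k (Y : nat -> 'cV[R]_nz) : 'cV[R]_(cdim p nz a) :=
  \sum_(1 <= j < k.+1) Psi a j *m invmx (S j) *m eta j Y.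

Definition predictor k (Y : nat -> 'cV[R]_nz) : 'cV[R]_nz :=
  L k *: (Del Signal k *m evec Signal k.-1 Y + Del Noise k *m evec Noise k.-1 Y
          + mu k).

Let yhat_linear k : (1 <= k)%N -> linear_estimator k.-1 (yhat k).
Proof. by move=> /yhat_LS[]. Qed.

Let second_order_est := @second_order_estimator _ _ _ P _ _ y_second_order.

Let second_order_eta := second_order_innovation y_second_order yhat_linear eta_eq.

Lemma evecS a k Y :
  evec a k.+1 Y = evec a k Y + Psi a k.+1 *m invmx (S k.+1) *m eta k.+1 Y.
Proof. by rewrite /evec big_nat_recr. Qed.

Lemma evec0 a Y : evec a 0 Y = 0.
Proof. by rewrite /evec big_geq. Qed.

Lemma TcovS a b k :
  Tcov k.+1 a b = Tcov k a b + Psi a k.+1 *m invmx (S k.+1) *m (Psi b k.+1)^T.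
Proof. by []. Qed.

Lemma S_sym k : (1 <= k)%N -> (S k)^T = S k.
Proof. by move=> k1; rewrite S_Cov// Cov_tr. Qed.

Lemma Tcov_tr a b k : (Tcov k a b)^T = Tcov k b a.
Proof.
elim: k => [|k IH]; first exact: trmx0.
by rewrite !TcovS linearD /= IH !trmx_mul trmxK trmx_inv S_sym// mulmxA.
Qed.

Lemma PsiE a k : Psi a k = L k *: ((Gam a k)^T
  - Tcov k.-1 a Signal *m (Del Signal k)^T - Tcov k.-1 a Noise *m (Del Noise k)^T).
Proof.
rewrite /Psi /gain; congr (_ *: _).
rewrite [LHS]linearB [X in X - _]linearB /= !trmx_mul.
by rewrite (Tcov_tr Signal) (Tcov_tr Noise).
Qed.

Lemma evec_linear a k : linear_estimator k (evec a k).
Proof.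
apply: linear_estimator_sum => j /andP[j1 jk]; apply: linear_estimatorM.
exact: linear_estimatorW (innovation_linear yhat_linear eta_eq j1).
Qed.

Lemma second_order_evec a k : second_order P (fun t => evec a k (y ^~ t)).
Proof. exact: second_order_est (evec_linear a k). Qed.

Let second_order_gain_eta a k : (1 <= k)%N ->
  second_order P (fun t => Psi a k *m invmx (S k) *m eta k (y ^~ t)).
Proof. by move=> k1; apply/second_orderM/second_order_eta. Qed.

Lemma mean_evec a k : orthogonal_innovations P y eta S k ->
  mean P (fun t => evec a k (y ^~ t)) = 0.
Proof.
elim: k => [|k IH] hS.
  by under eq_fun do rewrite evec0; rewrite mean_cst.
have [e0 _ _] := hS k.+1 (ltnSn _).
under eq_fun do rewrite evecS.
rewrite meanD//; [|exact: second_order_evec|exact: second_order_gain_eta].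
rewrite meanM ?e0 ?mulmx0 ?addr0; last exact: second_order_eta.
by rewrite IH//; apply: orthogonal_innovationsW hS.
Qed.

(** The moments [M j] with the innovations are left free: they are [Psi a j] when [X] is itself a
    vector [evec], and a combination of both gains when [X] is the estimated vector. *)
Lemma moment2_evecr n (X : Om -> 'cV[R]_n) (M : nat -> 'M[R]_(n, nz)) a k :
  second_order P X -> (forall j, (1 <= j <= k)%N -> moment2 P X (etay j) = M j) ->
  moment2 P X (fun t => evec a k (y ^~ t)) =
  \sum_(1 <= j < k.+1) M j *m invmx (S j) *m (Psi a j)^T.
Proof.
move=> hX; elim: k => [|k IH] hM.
  under [X in moment2 _ _ X]eq_fun do rewrite evec0.
  by rewrite moment2_cstr// trmx0 mulmx0 big_geq.
under [X in moment2 _ _ X]eq_fun do rewrite evecS.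
rewrite moment2Dr//; [|exact: second_order_evec|exact: second_order_gain_eta].
rewrite IH; last by move=> j /andP[j1 jk]; rewrite hM// j1 ltnW.
rewrite moment2Mr//; last exact: second_order_eta.
rewrite hM ?leqnn// [RHS]big_nat_recr//=.
by rewrite trmx_mul trmx_inv S_sym// mulmxA.
Qed.

Lemma Tcov_sum a b k :
  Tcov k a b = \sum_(1 <= j < k.+1) Psi a j *m invmx (S j) *m (Psi b j)^T.
Proof.
elim: k => [|k IH]; first by rewrite big_geq.
by rewrite TcovS IH [RHS]big_nat_recr.
Qed.

(** In the innovation expansion of [evec a k] only the term of index [j] survives, and there [S j]
    cancels its inverse. For [j = k.+1] the older terms form a linear estimator based on earlier
    data, hence are orthogonal to the new innovation. *)
Lemma moment2_evec_eta a k j : orthogonal_innovations P y eta S k ->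
  (1 <= j <= k)%N -> moment2 P (fun t => evec a k (y ^~ t)) (etay j) = Psi a j.
Proof.
elim: k => [|k IH] hS /andP[j1 jk]; first by have := leq_trans j1 jk.
have [e0 eS ei] := hS k.+1 (ltnSn _).
under [X in moment2 _ X _]eq_fun do rewrite evecS.
have hj := second_order_eta j1.
rewrite moment2Dl//; [|exact: second_order_evec|exact: second_order_gain_eta].
rewrite moment2Ml//; last exact: second_order_eta.
have hSk := orthogonal_innovationsW (leqnSn k) hS.
move: jk; rewrite leq_eqVlt => /predU1P[->|jk].
  rewrite eS mulmxKV ?S_unit// -[moment2 _ _ _]moment2_tr.
  rewrite (moment2_estimator y_second_order yhat_linear eta_eq _ e0 _ (evec_linear a k)).
  - by rewrite trmx0 add0r.
  - exact: second_order_eta.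
  - by move=> i /andP[i1 ik]; apply: ei; rewrite i1.
by rewrite ei ?j1// mulmx0 addr0 IH// j1.
Qed.

Lemma moment2_evec a b k : orthogonal_innovations P y eta S k ->
  moment2 P (fun t => evec a k (y ^~ t)) (fun t => evec b k (y ^~ t)) =
  Tcov k a b.
Proof.
move=> hS; rewrite Tcov_sum; apply: moment2_evecr => [|j].
  exact: second_order_evec.
exact: moment2_evec_eta.
Qed.

(* The estimated vector X is x_k (with c = 0) for the filter and y_k for the
   predictor of the observation. *)
Section Estimation.
Variables (n s : nat) (X : Om -> 'cV[R]_n) (c : 'cV[R]_n).
Variable U : forall a : component, 'M[R]_(n, cdim p nz a).
Hypothesis X_second_order : second_order P X.
Hypothesis X_mean : mean P X = c.
Hypothesis X_moment : forall j, (1 <= j <= s)%N ->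
  moment2 P X (y j) = L j *: (U Signal *m (Gam Signal j)^T
    + U Noise *m (Gam Noise j)^T + c *m (mu j)^T).
Hypothesis yhat_predictor : forall j Y, (1 <= j <= s)%N ->
  yhat j Y = predictor j Y.

(** By strong induction the moments of [X] with the earlier innovations reassemble into [U Signal *m
    Tcov _ Signal a + U Noise *m Tcov _ Noise a]. Subtracting the predictor of [y j] then turns each
    [Gam a j] into [Psi a j], and its constant [mu j] cancels the mean term [c *m (mu j)^T]. *)
Lemma moment2_innovation j : (1 <= j <= s)%N ->
  moment2 P X (etay j) = U Signal *m Psi Signal j + U Noise *m Psi Noise j.
Proof.
elim/ltn_ind: j => j IH /andP[j1 js].
under [X in moment2 _ _ X]eq_fun do rewrite eta_eq// yhat_predictor ?j1//.
have he a : moment2 P X (fun t => evec a j.-1 (y ^~ t)) =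
    U Signal *m Tcov j.-1 Signal a + U Noise *m Tcov j.-1 Noise a.
  rewrite (moment2_evecr _ X_second_order (M := fun i =>
    U Signal *m Psi Signal i + U Noise *m Psi Noise i)).
    rewrite !Tcov_sum !mulmx_sumr -big_split; apply: eq_bigr => i _.
    by rewrite !mulmxDl !mulmxA.
  move=> i /andP[i1 ij]; have ij' : (i < j)%N by rewrite -(prednK j1).
  by apply: IH => //; rewrite i1 (leq_trans (ltnW ij') js).
have hea a : second_order P (fun t => evec a j.-1 (y ^~ t)).
  exact: second_order_evec.
have hDe a : second_order P (fun t => Del a j *m evec a j.-1 (y ^~ t)).
  exact: second_orderM.
have hDD : second_order P (fun t => Del Signal j *m evec Signal j.-1 (y ^~ t)
    + Del Noise j *m evec Noise j.-1 (y ^~ t)) by exact: second_orderD.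
have hc := second_order_cst P (mu j).
have hy := y_second_order j1.
rewrite moment2Br//; last first.
  by apply: second_orderZ; apply: second_orderD.
rewrite moment2Zr//; last exact: second_orderD.
rewrite moment2Dr// moment2Dr// !moment2Mr// moment2_cstr// X_mean !he.
rewrite X_moment ?j1// -scalerBr !PsiE -!scalemxAr -scalerDr; congr (_ *: _).
rewrite !mulmxBr !mulmxDl !mulmxA.
(* The matrix products become atoms, leaving an entrywise identity for [ring]. *)
move: (U Signal *m _) (U Noise *m _) (c *m _) (_ *m _ *m _) (_ *m _ *m _)
  (_ *m _ *m _) (_ *m _ *m _) => a1 a2 a3 a4 a5 a6 a7.
by apply/matrixP => i l; rewrite !mxE; ring.
Qed.

(** The right-hand side has the mean of [X] and, by the two moment formulas above, the same moments
    as [X] with the innovations; uniqueness of the optimal estimator does the rest. *)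
Lemma LS_linear_estimatorE f : orthogonal_innovations P y eta S s ->
  LS_linear_estimator P y s X f ->
  forall Y, f Y = c + U Signal *m evec Signal s Y + U Noise *m evec Noise s Y.
Proof.
move=> hS hf.
have hU a : second_order P (fun t => U a *m evec a s (y ^~ t)).
  by apply: second_orderM; apply: second_order_evec.
have hc := second_order_cst P c.
have hcU := second_orderD hc (hU Signal).
apply: (LS_linear_estimator_unique y_second_order yhat_linear eta_eq S_unit hS
  X_second_order hf).
- apply: linear_estimatorD.
    apply: linear_estimatorD; first exact: linear_estimator_cst.
    exact/linear_estimatorM/evec_linear.
  exact/linear_estimatorM/evec_linear.
- rewrite meanB//; last exact: second_orderD.
  rewrite !meanD// mean_cst !meanM; [|exact: second_order_evec..].
  by rewrite !mean_evec// !mulmx0 !addr0 X_mean subrr.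
- move=> j js; have j1 : (1 <= j)%N by case/andP: js.
  have hj := second_order_eta j1; have [e0 _ _] := hS j js.
  rewrite moment2Bl//; last exact: second_orderD.
  rewrite !moment2Dl// moment2_cstl// e0 trmx0 mulmx0 add0r.
  rewrite !moment2Ml//; [|exact: second_order_evec..].
  by rewrite !moment2_evec_eta// moment2_innovation// subrr.
Qed.

End Estimation.

Lemma S_moment2 k : (1 <= k)%N -> mean P (etay k) = 0 ->
  moment2 P (etay k) (etay k) = S k.
Proof. by move=> k1 e0; rewrite S_Cov// Cov_zero_mean. Qed.

(** Breaks the circularity between predictors and orthogonality: what is known up to time [k]
    identifies the predictor at [k.+1], and this explicit form yields the properties of the next
    innovation. *)
Lemma innovation_step k : orthogonal_innovations P y eta S k ->
  (forall j Y, (1 <= j <= k)%N -> yhat j Y = predictor j Y) ->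
  [/\ forall Y, yhat k.+1 Y = predictor k.+1 Y,
      mean P (etay k.+1) = 0 &
      forall i, (1 <= i <= k)%N -> moment2 P (etay k.+1) (etay i) = 0].
Proof.
move=> hS hk; have k1 : (1 <= k.+1)%N by [].
have yhatE Y : yhat k.+1 Y = predictor k.+1 Y.
  rewrite (LS_linear_estimatorE (U := fun a => L k.+1 *: Del a k.+1)
    (y_second_order k1) (y_mean k1) _ hk hS (yhat_LS k1)).
    by rewrite /predictor -!scalemxAl !scalerDr -addrA addrC.
  by move=> j /andP[j1 jk]; rewrite y_moment ?j1.
have etaE : etay k.+1 = (fun t => y k.+1 t - predictor k.+1 (y ^~ t)).
  by apply/funext => t; rewrite eta_eq// yhatE.
have hy := y_second_order k1.
have hp : second_order P (fun t => predictor k.+1 (y ^~ t)).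
  have -> : (fun t => predictor k.+1 (y ^~ t)) = (fun t => yhat k.+1 (y ^~ t)).
    by apply/funext => t; rewrite yhatE.
  exact: second_order_est (yhat_linear k1).
have hDe a : second_order P (fun t => Del a k.+1 *m evec a k (y ^~ t)).
  by apply: second_orderM; apply: second_order_evec.
have hDD := second_orderD (hDe Signal) (hDe Noise).
have hm := second_order_cst P (mu k.+1).
have hDDm := second_orderD hDD hm.
split=> //.
  rewrite etaE meanB// y_mean// meanZ// !meanD// !meanM;
    [|exact: second_order_evec..].
  by rewrite !mean_evec// !mulmx0 !add0r mean_cst subrr.
move=> i ik; have i1 : (1 <= i)%N by case/andP: ik.
have hi := second_order_eta i1; have [e0 _ _] := hS i ik.
rewrite etaE moment2Bl// moment2Zl// !moment2Dl// moment2_cstl// e0.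
rewrite trmx0 mulmx0 addr0 !moment2Ml//; [|exact: second_order_evec..].
rewrite !moment2_evec_eta//.
rewrite (moment2_innovation (s := k) (U := fun a => L k.+1 *: Del a k.+1)
    (y_second_order k1) (y_mean k1))//.
  by rewrite -!scalemxAl scalerDr subrr.
by move=> j /andP[j1 jk]; rewrite y_moment ?j1.
Qed.

Lemma innovations k : orthogonal_innovations P y eta S k /\
  (forall j Y, (1 <= j <= k)%N -> yhat j Y = predictor j Y).
Proof.
elim: k => [|k [hS hk]]; first by split=> [j|j Y] /andP[j1 /(leq_trans j1)].
have [hy e0 ei] := innovation_step hS hk.
split=> [j|j Y] /andP[j1]; rewrite leq_eqVlt => /predU1P[->//|jk].
- by split=> //; exact: S_moment2.
- by apply: hS; rewrite j1.
- by apply: hk; rewrite j1.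
Qed.

(** [y k] is the orthogonal sum of its innovation and its predictor, so [S k] is the moment of [y k]
    minus that of the predictor. In the latter the cross terms with [mu k] vanish since the vectors
    [evec] have zero mean. *)
Lemma innovation_covariance k : (1 <= k)%N ->
  S k = moment2 P (y k) (y k) - L k ^+ 2 *:
    ((Del Signal k *m Tcov k.-1 Signal Signal
        + Del Noise k *m Tcov k.-1 Noise Signal) *m (Del Signal k)^T
     + (Del Signal k *m Tcov k.-1 Signal Noise
        + Del Noise k *m Tcov k.-1 Noise Noise) *m (Del Noise k)^T
     + mu k *m (mu k)^T).
Proof.
move=> k1; have [hS hk] := innovations k.
have kk : (1 <= k <= k)%N by rewrite k1 leqnn.
have [e0 eS ei] := hS k kk.
have hS' := orthogonal_innovationsW (leq_pred k) hS.
have hy := y_second_order k1; have he := second_order_eta k1.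
have hyh := second_order_est (yhat_linear k1).
have eyh : moment2 P (etay k) (fun t => yhat k (y ^~ t)) = 0.
  apply: (moment2_estimator y_second_order yhat_linear eta_eq he e0 _
    (yhat_linear k1)) => i /andP[i1 ik].
  by apply: ei; rewrite i1 -(prednK k1) ltnS.
have etaE : etay k = (fun t => y k t - yhat k (y ^~ t)).
  by apply/funext => t; rewrite eta_eq.
have yE : y k = fun t => eta k (y ^~ t) + yhat k (y ^~ t).
  by apply/funext => t; rewrite eta_eq// subrK.
have -> : moment2 P (y k) (y k) = S k +
    moment2 P (fun t => yhat k (y ^~ t)) (fun t => yhat k (y ^~ t)).
  rewrite yE moment2Dl//; last exact: second_orderD.
  by rewrite !moment2Dr// eS eyh -[moment2 P _ (etay k)]moment2_tr eyh trmx0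
    addr0 add0r.
have -> : (fun t => yhat k (y ^~ t)) = (fun t => predictor k (y ^~ t)).
  by apply/funext => t; rewrite hk.
rewrite /predictor; have hee a := @second_order_evec a k.-1.
have hDe a : second_order P (fun t => Del a k *m evec a k.-1 (y ^~ t)).
  by apply: second_orderM.
have hDD := second_orderD (hDe Signal) (hDe Noise).
have hm := second_order_cst P (mu k).
have hDDm := second_orderD hDD hm.
have Z n (c : 'cV[R]_n) a :
    moment2 P (fun=> c) (fun t => evec a k.-1 (y ^~ t)) = 0.
  by rewrite moment2_cstl// mean_evec// trmx0 mulmx0.
have Z' n (c : 'cV[R]_n) a :
    moment2 P (fun t => evec a k.-1 (y ^~ t)) (fun=> c) = 0.
  by rewrite -moment2_tr Z trmx0.
rewrite moment2Zl ?moment2Zr//; last exact: second_orderZ.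
rewrite scalerA -expr2 !moment2Dr// !moment2Dl// !moment2Mr// !moment2Ml//.
rewrite !moment2_evec// !Z Z' Z' moment2_cstl// mean_cst !mulmx0 !mul0mx.
by rewrite !addr0 !add0r !mulmxDl addrK.
Qed.

End Recursion.

(** * Independence and expectation of products *)

Section IndependentProduct.
Context d (T : measurableType d) (R : realType) (P : probability T R).

Definition indep_events (A B : set T) := P (A `&` B) = (P A * P B)%E.

(* The joint law of an independent pair is the product of the marginal laws,
   so that the expectation of the product factors by Fubini's theorem. *)
Lemma indep_expectationM (X Y : T -> R) :
  X \in Lfun P 1 -> Y \in Lfun P 1 ->
  (forall U V, measurable U -> measurable V ->
     indep_events (X @^-1` U) (Y @^-1` V)) ->
  ('E_P[fun t => (X t * Y t)%R] = 'E_P[X] * 'E_P[Y])%E.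
Proof.
move=> hX hY ind; have mX := Lfun_measurable hX; have mY := Lfun_measurable hY.
pose X' : {RV P >-> R} := HB.pack X (isMeasurableFun.Build _ _ _ _ X mX).
pose Y' : {RV P >-> R} := HB.pack Y (isMeasurableFun.Build _ _ _ _ Y mY).
have mXY : measurable_fun setT (fun t => (X t, Y t)) by exact: measurable_fun_pair.
pose Z : {RV P >-> (R * R)%type} :=
  HB.pack (fun t => (X t, Y t)) (isMeasurableFun.Build _ _ _ _ _ mXY).
pose m1 := distribution P X'; pose m2 := distribution P Y'.
have hE := @product_measure_unique _ _ _ _ R m1 m2 (distribution P Z).
have {}hE : forall W, measurable W -> (m1 \x m2)%E W = distribution P Z W.
  by apply: hE => A B mA mB; exact: ind.
pose f (z : R * R) := (z.1 * z.2)%:E.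
have mf : measurable_fun setT f.
  by apply/measurable_EFinP; apply: measurable_funM.
have iX := (Lfun1_integrable P X).1 hX.
have iY := (Lfun1_integrable P Y).1 hY.
have i2 : m2.-integrable setT EFin.
  by apply: integrable_pushforward.
have i1 : m1.-integrable setT EFin.
  by apply: integrable_pushforward.
(* Fubini needs joint integrability: by Tonelli, the integral of the absolute value is the product
   of the two first absolute moments. *)
have intf : (m1 \x m2)%E.-integrable setT f.
  apply/integrable12ltyP => //.
  under eq_integral => x _.
    under eq_integral => z _ do rewrite /f/= normrM EFinM.
    rewrite ge0_integralZl//; last exact: measurableT_comp.
    over.
  rewrite /= ge0_integralZr//; last 2 first.
  - exact: measurableT_comp.
  - exact: integral_ge0.
  apply: lte_mul_pinfty; first exact: integral_ge0.
    exact: integrable_fin_num (integrable_abse i1).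
  by case/integrableP : i2.
have iXY : P.-integrable setT (f \o Z).
  apply/integrableP; split; first exact: measurableT_comp.
  have mabs : measurable_fun setT (abse \o f) by exact: measurableT_comp.
  have := @ge0_integral_distribution _ _ _ _ _ P Z _ mabs (fun z => abse_ge0 _).
  rewrite (eq_measure_integral (m1 \x m2)%E); last by move=> A mA _; rewrite [RHS]hE.
  by move=> <-; case/integrableP : intf.
have -> : ('E_P[fun t => (X t * Y t)%R] = \int[m1]_x \int[m2]_y f (x, y))%E.
  rewrite integral12_prod_meas1// (eq_measure_integral (distribution P Z)).
    by rewrite unlock integral_distribution.
  by move=> A mA _; exact: hE.
under eq_integral => x _.
  rewrite /f /=; under eq_integral => z _ do rewrite EFinM.
  rewrite integralZl//.
  over.
have -> : (\int[m2]_z z%:E = 'E_P[Y])%E.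
  by rewrite unlock (@integral_distribution _ _ _ _ _ P Y' EFin).
have -> : ('E_P[Y] = (fine 'E_P[Y])%:E)%E.
  by rewrite fineK// expectation_fin_num.
rewrite /= integralZr//; congr (_ * _)%E.
by rewrite unlock (@integral_distribution _ _ _ _ _ P X' EFin).
Qed.

Lemma indep_eventsC (A B : set T) : measurable A -> measurable B ->
  indep_events A B -> indep_events (~` A) B.
Proof.
move=> mA mB AB; rewrite /indep_events setIC -setDE.
have Bfin : (P B < +oo)%E by rewrite -ge0_fin_numE// fin_num_measure.
rewrite measureD// setIC [X in (_ - X)%E](_ : _ = (P A * P B)%E)//.
by rewrite probability_setC// muleBl ?fin_num_measure// mul1e.
Qed.

Lemma indep_eventsU (A A' B : set T) : measurable A -> measurable A' ->
  measurable B -> [disjoint A & A'] -> indep_events A B -> indep_events A' B ->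
  indep_events (A `|` A') B.
Proof.
move=> mA mA' mB /disj_setPS AA' AB A'B.
have A0 : A `&` A' = set0 by rewrite -subset0.
have AB0 : (A `&` B) `&` (A' `&` B) = set0.
  by rewrite setIACA A0 set0I.
rewrite /indep_events setIUl.
have -> : P ((A `&` B) `|` (A' `&` B)) = (P (A `&` B) + P (A' `&` B))%E.
  by rewrite measureU//; exact: measurableI.
have -> : P (A `|` A') = (P A + P A')%E by rewrite measureU.
rewrite (AB : P (A `&` B) = _) (A'B : P (A' `&` B) = _).
by rewrite muleDl ?fin_num_measure// ge0_adde_def// inE measure_ge0.
Qed.

Lemma Lfun1_indicM (S : set T) (X : T -> R) : measurable S ->
  X \in Lfun P 1 -> (fun t => \1_S t * X t) \in Lfun P 1.
Proof.
move=> mS /[dup] hX /Lfun1_integrable iX; apply/Lfun1_integrable.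
apply: le_integrable iX => //.
  apply/measurable_EFinP; apply: measurable_funM; first exact: measurable_indic.
  exact: Lfun_measurable hX.
move=> t _ /=; rewrite lee_fin normrM indicE.
by case: (t \in S) => /=; rewrite ?normr1 ?normr0 ?mul1r ?mul0r.
Qed.

(** Off [S] the product is 0, so the complement of [S] contributes exactly when 0 lies in [U]. The
    union is disjoint, which reduces independence of the product to that of events inside [S]. *)
Lemma preimage_indicM (S : set T) (X : T -> R) (U : set R) :
  (fun t => \1_S t * X t) @^-1` U =
  (S `&` X @^-1` U) `|` (if 0 \in U then ~` S else set0).
Proof.
apply/seteqP; split=> t /=; rewrite indicE.
  case: (boolP (t \in S)) => [/set_mem tS|/negP tS]; rewrite ?mul1r ?mul0r => Ut.
    by left.
  by right; rewrite mem_set//; move=> /mem_set.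
case=> [[/mem_set -> ]|]; first by rewrite mul1r.
case: ifPn => // /set_mem U0 /= tS; rewrite memNset// mul0r//.
Qed.

Lemma indep_events_indicM (S B : set T) (X : T -> R) (U : set R) :
  measurable S -> measurable_fun setT X -> measurable B -> measurable U ->
  (forall V, measurable V -> indep_events (S `&` X @^-1` V) B) ->
  indep_events ((fun t => \1_S t * X t) @^-1` U) B.
Proof.
move=> mS mX mB mU ind; rewrite preimage_indicM.
have mXV V : measurable V -> measurable (X @^-1` V).
  by move=> mV; rewrite -[X in measurable X]setTI; apply: mX.
apply: indep_eventsU => //.
- by apply: measurableI => //; apply: mXV.
- by case: ifP => // _; exact: measurableC.
- apply/disj_setPS => t [[St _]]; by case: ifP.
- exact: ind.
case: ifP => [_|_]; last by rewrite /indep_events set0I measure0 mul0e.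
apply: indep_eventsC => //.
(* Taking the whole line for [V] gives independence of [S] itself, which passes to its
   complement. *)
by have := ind setT measurableT; rewrite preimage_setT setIT.
Qed.

Lemma expectation_indicM (S : set T) (X : T -> R) : measurable S ->
  X \in Lfun P 1 ->
  (forall U, measurable U -> indep_events S (X @^-1` U)) ->
  ('E_P[fun t => (\1_S t * X t)%R] = P S * 'E_P[X])%E.
Proof.
move=> mS hX ind; have mX := Lfun_measurable hX.
have mXV V : measurable V -> measurable (X @^-1` V).
  by move=> mV; rewrite -[X in measurable X]setTI; apply: mX.
(* The indicator is treated as the product [\1_S * 1], so that the lemma on masked variables covers
   it. *)
have c1 : cst 1 \in Lfun P 1 := Lfun_cst P 1 1.
have S1 := Lfun1_indicM mS c1.
have E1 : (fun t => \1_S t * cst (1 : R) t) = \1_S.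
  by apply/funext => t; rewrite /= mulr1.
have ind' U V : measurable U -> measurable V ->
    indep_events ((fun t => \1_S t * cst (1 : R) t) @^-1` U) (X @^-1` V).
  move=> mU mV; apply: indep_events_indicM => //; first exact: mXV.
  move=> W mW; rewrite preimage_cst.
  case: ifP => _; first by rewrite setIT; exact: ind.
  by rewrite setI0 /indep_events set0I measure0 mul0e.
rewrite -(expectation_indic P mS) -E1 -(indep_expectationM S1 hX ind').
by congr expectation; apply/funext => t /=; rewrite mulr1.
Qed.

(** Independence of three factors is used in two binary stages: [\1_S * X] against [Y], then [\1_S]
    against [X]. *)
Lemma expectation_indicMM (S : set T) (X Y : T -> R) : measurable S ->
  X \in Lfun P 1 -> Y \in Lfun P 1 ->
  (forall U V, measurable U -> measurable V ->
     P (S `&` (X @^-1` U `&` Y @^-1` V)) =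
     (P S * (P (X @^-1` U) * P (Y @^-1` V)))%E) ->
  ('E_P[fun t => (\1_S t * (X t * Y t))%R] = P S * ('E_P[X] * 'E_P[Y]))%E.
Proof.
move=> mS hX hY ind.
have SX U : measurable U -> indep_events S (X @^-1` U).
  move=> mU; have := ind U setT mU measurableT.
  by rewrite preimage_setT setIT probability_setT mule1.
have -> : (fun t => \1_S t * (X t * Y t)) = (fun t => (\1_S t * X t) * Y t).
  by apply/funext => t; rewrite mulrA.
have ind' U V : measurable U -> measurable V ->
    indep_events ((fun t => \1_S t * X t) @^-1` U) (Y @^-1` V).
  move=> mU mV; apply: indep_events_indicM => //.
  - exact: Lfun_measurable hX.
  - rewrite -[X in measurable X]setTI.
    by apply: (Lfun_measurable hY).
  by move=> W mW; rewrite /indep_events -setIA ind// (SX _ mW : P _ = _) muleA.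
rewrite (indep_expectationM (Lfun1_indicM mS hX) hY ind').
by rewrite expectation_indicM// muleA.
Qed.

End IndependentProduct.

(** * Random vectors masked by events of independent processes *)

Section Masks.
Context d (T : measurableType d) (R : realType) (P : probability T R).

Lemma Lfun2_indicM (S : set T) (f : T -> R) : measurable S ->
  f \in Lfun P 2%:E -> (fun t => \1_S t * f t) \in Lfun P 2%:E.
Proof.
move=> mS hf; have mf := Lfun_measurable hf.
have mSf : measurable_fun setT (fun t => \1_S t * f t).
  by apply: measurable_funM => //; exact: measurable_indic.
have h1 : 1 <= 2 :> R by rewrite ler1n.
have /integrableP[_ fy] := Lfun_integrable h1 hf.
apply/andP; split; rewrite inE//= /finite_norm unlock /Lnorm poweR_lty//.
apply: le_lt_trans fy; apply: ge0_le_integral => //.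
- by move=> t _; rewrite poweR_ge0.
- have : measurable_fun setT (EFin \o (fun t => `|\1_S t * f t| `^ 2)).
    apply/measurable_EFinP.
    apply: (@measurableT_comp _ _ _ _ _ _ (fun x => x `^ 2)) => //.
    exact: measurableT_comp.
  by [].
- apply/measurable_EFinP; apply: measurableT_comp => //.
  apply: (@measurableT_comp _ _ _ _ _ _ (fun x => x `^ 2)) => //.
  exact: measurableT_comp.
move=> t _ /=; rewrite lee_fin [leRHS]ger0_norm ?powR_ge0//.
rewrite indicE; case: (t \in S) => /=; first by rewrite mul1r.
by rewrite mul0r normr0 powR0 ?powR_ge0.
Qed.

Definition indic_vec (S : set T) n (X : T -> 'cV[R]_n) : T -> 'cV[R]_n :=
  fun t => \1_S t *: X t.

Lemma second_order_indic_vec S n (X : T -> 'cV[R]_n) : measurable S ->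
  second_order P X -> second_order P (indic_vec S X).
Proof.
move=> mS hX i; rewrite /indic_vec; under eq_fun do rewrite mxE.
exact: Lfun2_indicM.
Qed.

Definition measurable_wrt (F : set_system T) (f : T -> R) :=
  forall U, measurable U -> F (f @^-1` U).

Definition vmeasurable_wrt (F : set_system T) n (X : T -> 'cV[R]_n) :=
  forall i, measurable_wrt F (fun t => X t i 0).

Section MutuallyIndependent.
Variables (I : choiceType) (D : set I) (F : I -> set_system T).
Hypothesis F_indep : mutually_independent P D F.
Hypothesis F_setT : forall i, D i -> F i setT.
Hypothesis F_measurable : forall i, D i -> F i `<=` measurable.

(** Four members suffice for all moments below: the two Bernoulli processes supply the masks, and at
    most two vector processes supply the factors. Vacant places are filled with [setT]. *)
Lemma mutually_independent4 i j k l (A B C E : set T) :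
  uniq [:: i; j; k; l] -> D i -> D j -> D k -> D l ->
  F i A -> F j B -> F k C -> F l E ->
  (P (A `&` (B `&` (C `&` E))) = P A * (P B * (P C * P E)))%E.
Proof.
move=> ijkl Di Dj Dk Dl FA FB FC FE.
pose G m := if m == i then A else if m == j then B else if m == k then C else E.
have := F_indep (A := G) ijkl; rewrite bigcap_seq !big_cons !big_nil.
move: ijkl; rewrite /= !inE !negb_or -!andbA => /and5P[ij ik il jk /and3P[jl kl _]].
rewrite /G eqxx (eq_sym j i) (negbTE ij) eqxx (eq_sym k i) (negbTE ik).
rewrite (eq_sym k j) (negbTE jk) eqxx (eq_sym l i) (negbTE il).
rewrite (eq_sym l j) (negbTE jl) (eq_sym l k) (negbTE kl) setIT mule1; apply.
move=> m; rewrite !inE => /or4P[] /eqP ->.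
- by rewrite eqxx.
- by rewrite (eq_sym j i) (negbTE ij) eqxx.
- by rewrite (eq_sym k i) (negbTE ik) (eq_sym k j) (negbTE jk) eqxx.
- by rewrite (eq_sym l i) (negbTE il) (eq_sym l j) (negbTE jl) (eq_sym l k)
    (negbTE kl).
Qed.

Section Quadruple.
Variables i j k l : I.
Hypotheses (ijkl : uniq [:: i; j; k; l]) (Di : D i) (Dj : D j) (Dk : D k)
  (Dl : D l).

Lemma expectation_indic_vec2 (A B : set T) (f g : T -> R) :
  F i A -> F j B -> measurable_wrt (F k) f -> measurable_wrt (F l) g ->
  f \in Lfun P 1 -> g \in Lfun P 1 ->
  fine 'E_P[fun t => \1_(A `&` B) t * (f t * g t)] =
  fine (P A) * fine (P B) * (fine 'E_P[f] * fine 'E_P[g]).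
Proof.
move=> FA FB Ff Fg hf hg.
have mA := F_measurable Di FA; have mB := F_measurable Dj FB.
have PAB : (P (A `&` B) = P A * P B)%E.
  have := mutually_independent4 ijkl Di Dj Dk Dl FA FB (F_setT Dk) (F_setT Dl).
  by rewrite !setIT probability_setT !mule1.
rewrite expectation_indicMM//; last first.
- move=> U V mU mV; rewrite -setIA.
  rewrite (mutually_independent4 ijkl Di Dj Dk Dl FA FB (Ff U mU) (Fg V mV)).
  by rewrite PAB !muleA.
- exact: measurableI.
by rewrite PAB !fineM// ?fin_numM ?expectation_fin_num ?fin_num_measure.
Qed.

Lemma expectation_indic_vec (A B : set T) (f : T -> R) :
  F i A -> F j B -> measurable_wrt (F k) f -> f \in Lfun P 1 ->
  fine 'E_P[fun t => \1_(A `&` B) t * f t] =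
  fine (P A) * fine (P B) * fine 'E_P[f].
Proof.
move=> FA FB Ff hf.
have mA := F_measurable Di FA; have mB := F_measurable Dj FB.
have PAB : (P (A `&` B) = P A * P B)%E.
  have := mutually_independent4 ijkl Di Dj Dk Dl FA FB (F_setT Dk) (F_setT Dl).
  by rewrite !setIT probability_setT !mule1.
rewrite expectation_indicM//; last first.
- move=> U mU; rewrite /indep_events -setIA.
  have := mutually_independent4 ijkl Di Dj Dk Dl FA FB (Ff U mU) (F_setT Dl).
  by rewrite !setIT probability_setT !mule1 PAB muleA.
- exact: measurableI.
by rewrite PAB !fineM// ?fin_numM ?expectation_fin_num ?fin_num_measure.
Qed.

Lemma mean_indic_vec (A B : set T) n (X : T -> 'cV[R]_n) :
  F i A -> F j B -> vmeasurable_wrt (F k) X -> second_order P X ->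
  mean P (indic_vec (A `&` B) X) = (fine (P A) * fine (P B)) *: mean P X.
Proof.
move=> FA FB FX hX; apply/colP => a; rewrite !mxE /indic_vec.
under eq_fun do rewrite mxE.
by rewrite expectation_indic_vec//; apply: Lfun2_Lfun1.
Qed.

(** [A] and [A'] may concern two time instants of one process; regrouping the four masks by process
    leaves one event per sigma-algebra. *)
Lemma moment2_indic_vec_indep (A A' B B' : set T) m n (X : T -> 'cV[R]_m)
    (Y : T -> 'cV[R]_n) :
  F i (A `&` A') -> F j (B `&` B') -> vmeasurable_wrt (F k) X ->
  vmeasurable_wrt (F l) Y -> second_order P X -> second_order P Y ->
  moment2 P (indic_vec (A `&` B) X) (indic_vec (A' `&` B') Y) =
  (fine (P (A `&` A')) * fine (P (B `&` B'))) *: (mean P X *m (mean P Y)^T).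
Proof.
move=> FA FB FX FY hX hY; apply/matrixP => a b; rewrite !mxE /indic_vec big_ord1 !mxE.
rewrite -expectation_indic_vec2//; try exact: Lfun2_Lfun1.
congr (fine 'E_P[_]); apply/funext => t; rewrite !mxE mulrACA; congr (_ * _).
by rewrite setIACA [in RHS]indicI.
Qed.

(** Here [X] and [Y] may be correlated: each product of coordinates counts as a single variable
    measurable for [F k]. *)
Lemma moment2_indic_vec (A A' B B' : set T) m n (X : T -> 'cV[R]_m)
    (Y : T -> 'cV[R]_n) :
  F i (A `&` A') -> F j (B `&` B') ->
  (forall a b, measurable_wrt (F k) (fun t => X t a 0 * Y t b 0)) ->
  second_order P X -> second_order P Y ->
  moment2 P (indic_vec (A `&` B) X) (indic_vec (A' `&` B') Y) =
  (fine (P (A `&` A')) * fine (P (B `&` B'))) *: moment2 P X Y.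
Proof.
move=> FA FB FXY hX hY; apply/matrixP => a b; rewrite !mxE /indic_vec.
rewrite -expectation_indic_vec//; last exact: Lfun2_mul_Lfun1.
congr (fine 'E_P[_]); apply/funext => t; rewrite !mxE mulrACA; congr (_ * _).
by rewrite setIACA [in RHS]indicI.
Qed.

End Quadruple.
End MutuallyIndependent.

Section GeneratedSigmaAlgebra.
Variable G : set_system T.

Lemma measurable_wrtE (f : T -> R) : measurable_wrt <<s G>> f <->
  @measurable_fun _ _ (g_sigma_algebraType G) R setT f.
Proof.
split=> [h _ U mU|h U mU]; first by rewrite setTI; exact: h.
by have := h measurableT U mU; rewrite setTI.
Qed.

Lemma measurable_wrt_cst (c : R) : measurable_wrt <<s G>> (fun=> c).
Proof. by apply/measurable_wrtE; exact: measurable_cst. Qed.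

Lemma measurable_wrtD (f g : T -> R) : measurable_wrt <<s G>> f ->
  measurable_wrt <<s G>> g -> measurable_wrt <<s G>> (fun t => f t + g t).
Proof.
by move=> /measurable_wrtE hf /measurable_wrtE hg; apply/measurable_wrtE;
  exact: measurable_funD.
Qed.

Lemma measurable_wrtM (f g : T -> R) : measurable_wrt <<s G>> f ->
  measurable_wrt <<s G>> g -> measurable_wrt <<s G>> (fun t => f t * g t).
Proof.
by move=> /measurable_wrtE hf /measurable_wrtE hg; apply/measurable_wrtE;
  exact: measurable_funM.
Qed.

Lemma vmeasurable_wrt_affine m n (M : 'M[R]_(m, n)) (c : 'cV[R]_m)
    (X : T -> 'cV[R]_n) : vmeasurable_wrt <<s G>> X ->
  vmeasurable_wrt <<s G>> (fun t => M *m X t + c).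
Proof.
move=> hX i; under eq_fun do rewrite !mxE.
apply: measurable_wrtD; last exact: measurable_wrt_cst.
elim: (index_enum _) => [|a s IH].
  by under eq_fun do rewrite big_nil; exact: measurable_wrt_cst.
under eq_fun do rewrite big_cons; apply: measurable_wrtD => //.
by apply: measurable_wrtM => //; exact: measurable_wrt_cst.
Qed.

End GeneratedSigmaAlgebra.

Lemma sigma_vprocess_measurable n (D : set nat) (X : nat -> T -> 'cV[R]_n) :
  (forall k, D k -> second_order P (X k)) ->
  sigma_vprocess D X `<=` measurable.
Proof.
move=> hX; apply: smallest_sub; first exact: sigma_algebra_measurable.
move=> A [k Dk [i _ [U mU <-]]].
by apply: (Lfun_measurable (hX k Dk i)).
Qed.

Lemma sigma_process_measurable (D : set nat) (X : nat -> {mfun T >-> R}) :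
  sigma_process D X `<=` measurable.
Proof.
apply: smallest_sub; first exact: sigma_algebra_measurable.
by move=> A [k Dk [U mU <-]]; apply: measurable_funP.
Qed.

Lemma vmeasurable_wrt_process n (D : set nat) (X : nat -> T -> 'cV[R]_n) k :
  D k -> vmeasurable_wrt (sigma_vprocess D X) (X k).
Proof.
move=> Dk i U mU; apply: sub_sigma_algebra; exists k => //; exists i => //.
by exists U; rewrite ?setTI.
Qed.

Lemma sigma_process_preimage (D : set nat) (X : nat -> T -> R) k U :
  D k -> measurable U -> sigma_process D X (X k @^-1` U).
Proof.
move=> Dk mU; apply: sub_sigma_algebra; exists k => //.
by exists U; rewrite ?setTI.
Qed.

End Masks.

(** * Covariance of the additive noise *)

Section NoiseCovariance.
Context d (Om : measurableType d) (R : realType) (P : probability Om R) (nz : nat).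
Variables (v u : nat -> Om -> 'cV[R]_nz) (D Su Sv E F : nat -> 'M[R]_nz).
Hypothesis v0_second_order : second_order P (v 0%N).
Hypothesis v0_zero_mean : mean P (v 0%N) = 0.
Hypothesis v0_cov : Cov P (v 0%N) (v 0%N) = Sv 0%N.
Hypothesis D_nonsingular : forall k, D k \in unitmx.
Hypothesis v_eq : forall k t, (1 <= k)%N ->
  v k t = D k.-1 *m v k.-1 t + u k.-1 t.
Hypothesis u_white : white_noise P setT u Su.
Hypothesis u_v0_indep : mutually_independent P `I_2
  (nth set0 [:: sigma_vprocess setT u; sigma_vprocess [set 0%N] v]).
Hypothesis Sv_eq : forall s, (1 <= s)%N ->
  Sv s = D s.-1 *m Sv s.-1 *m (D s.-1)^T + Su s.-1.
Hypothesis E_0 : E 0%N = 1%:M.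
Hypothesis E_eq : forall k, (1 <= k)%N -> E k = D k.-1 *m E k.-1.
Hypothesis F_eq : forall s, (1 <= s)%N -> F s = Sv s *m (invmx (E s))^T.

Let vS k : v k.+1 = fun t => D k *m v k t + u k t.
Proof. by apply/funext => t; rewrite v_eq. Qed.

Let hu k : second_order P (u k).
Proof. by case: u_white => + _ _ _; exact. Qed.

Let u0 k : mean P (u k) = 0.
Proof. by case: u_white => _ + _ _; exact. Qed.

Lemma noise_second_order k : second_order P (v k).
Proof.
elim: k => // k IH; rewrite vS.
by apply: second_orderD; [exact: second_orderM|exact: hu].
Qed.

Let hv := noise_second_order.
Let hDv k j : second_order P (fun t => D j *m v k t).
Proof. exact/second_orderM/hv. Qed.

Lemma noise_mean k : mean P (v k) = 0.
Proof.
elim: k => // k IH.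
by rewrite vS meanD ?meanM ?IH ?u0 ?mulmx0 ?addr0.
Qed.

Let moment2_uv0 j : moment2 P (u j) (v 0%N) = 0.
Proof.
apply/matrixP => a b; rewrite mxE [RHS]mxE.
rewrite (@indep_expectationM _ _ _ _ (fun t => u j t a 0) (fun t => v 0%N t b 0)).
- have /(congr1 (fun M : 'cV_nz => M a 0)) := u0 j; rewrite !mxE => ua0.
  rewrite fineM ?ua0 ?mul0r//; apply: expectation_fin_num; apply: Lfun2_Lfun1;
    [exact: hu|exact: hv].
- exact/Lfun2_Lfun1/hu.
- exact/Lfun2_Lfun1/hv.
move=> U V mU mV; have := u_v0_indep (J := [:: 0%N; 1%N])
  (A := nth set0 [:: (fun t => u j t a 0) @^-1` U; (fun t => v 0%N t b 0) @^-1` V]).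
rewrite bigcap_seq !big_cons !big_nil /= setIT mule1; apply=> // i.
rewrite !inE => /orP[] /eqP -> /=; split=> //.
  by apply: vmeasurable_wrt_process.
by apply: vmeasurable_wrt_process.
Qed.

(** [v s] is built from [v 0] and the [u i] with [i < s], all orthogonal to [u j] once [s <= j]. *)
Let moment2_uv j s : (s <= j)%N -> moment2 P (u j) (v s) = 0.
Proof.
elim: s => [_|s IH sj]; first exact: moment2_uv0.
rewrite vS moment2Dr ?moment2Mr// IH ?mul0mx ?add0r; last exact: ltnW.
case: u_white => _ _ _ uncor; rewrite -Cov_zero_mean//.
by apply: uncor => //; rewrite gtn_eqF.
Qed.

Lemma noise_moment2_diag s : moment2 P (v s) (v s) = Sv s.
Proof.
elim: s => [|s IH].
  by rewrite -Cov_zero_mean// noise_mean.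
case: u_white => _ _ Cu _; have {}Cu := Cu s I.
rewrite Sv_eq//= vS moment2Dl//; last exact: second_orderD.
rewrite !moment2Dr// !moment2Ml// !moment2Mr// moment2_uv// mul0mx add0r.
by rewrite -[moment2 _ (v s) (u s)]moment2_tr moment2_uv// trmx0 mulmx0 addr0 IH
  -Cu Cov_zero_mean// mulmxA.
Qed.

Let E_unit k : E k \in unitmx.
Proof.
by elim: k => [|k IH]; rewrite ?E_0 ?unitmx1// E_eq// unitmx_mul D_nonsingular.
Qed.

(** [E k *m invmx (E s)] is the transition matrix from time [s] to time [k]. At [k = s] it is the
    identity, and each further step multiplies by [D k] on the left, the fresh noise being
    orthogonal to [v s]. *)
Lemma noise_moment2 k s : (1 <= s)%N -> (s <= k)%N ->
  moment2 P (v k) (v s) = E k *m (F s)^T.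
Proof.
move=> s1; rewrite F_eq// trmx_mul trmxK mulmxA.
have -> : (Sv s)^T = Sv s by rewrite -noise_moment2_diag moment2_tr.
elim: k => [|k IH]; first by rewrite leqNgt s1.
rewrite leq_eqVlt => /predU1P[<-|].
  by rewrite mulmxV ?E_unit// mul1mx noise_moment2_diag.
rewrite ltnS => sk; rewrite vS moment2Dl// moment2Ml// moment2_uv// addr0 IH//.
by rewrite (E_eq (k := k.+1))//= !mulmxA.
Qed.

End NoiseCovariance.

(** * Bernoulli variables as indicators, and moments under almost sure equality *)

Section Bernoulli.
Context d (T : measurableType d) (R : realType) (P : probability T R).

(** The values 0 and 1 carry total probability one; elsewhere the variable is unconstrained, so the
    equality is only almost sure. *)
Lemma bernoulli_indic (X : {RV P >-> R}) q : is_bernoulli P X q ->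
  \forall t \ae P, X t = \1_(X @^-1` [set 1]) t.
Proof.
move=> [P1 P0].
have m1 : measurable (X @^-1` [set 1]) by apply: measurable_funPTI.
have m0 : measurable (X @^-1` [set 0]) by apply: measurable_funPTI.
exists (~` (X @^-1` [set 1] `|` X @^-1` [set 0])); split.
- by apply: measurableC; exact: measurableU.
- rewrite probability_setC; last exact: measurableU.
  have -> : P (X @^-1` [set 1] `|` X @^-1` [set 0]) =
      (P (X @^-1` [set 1%R]) + P (X @^-1` [set 0%R]))%E.
    rewrite measureU//; apply/seteqP; split=> // t [/= ->] /eqP.
    by rewrite oner_eq0.
  have q1 : (q%:E + (1 - q)%:E = 1%:E)%E by rewrite -EFinD subrKC.
  by rewrite P1 P0 q1 subee.
move=> t /= tX [|] Xt; apply: tX; rewrite indicE Xt.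
  by rewrite mem_set.
by rewrite memNset//= Xt => /eqP; rewrite eq_sym oner_eq0.
Qed.

Section AlmostEverywhere.
Variables (n : nat) (X X' : T -> 'cV[R]_n).
Hypothesis X_measurable : forall i, measurable_fun setT (fun t => X t i 0).
Hypothesis X'_second_order : second_order P X'.
Hypothesis XX' : \forall t \ae P, X t = X' t.

Lemma second_order_ae : second_order P X.
Proof.
move=> i; apply: Lfun2_ae_eq (X'_second_order i) => //.
by apply: filterS XX' => t ->.
Qed.

Lemma mean_ae : mean P X = mean P X'.
Proof.
apply/colP => i; rewrite !mxE; congr fine; apply: expectation_ae_eq => //.
  exact: Lfun_measurable (X'_second_order i).
by apply: filterS XX' => t ->.
Qed.

Lemma moment2_ael m (Z : T -> 'cV[R]_m) : second_order P Z ->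
  moment2 P X Z = moment2 P X' Z.
Proof.
move=> hZ; apply/matrixP => i j; rewrite !mxE; congr fine.
apply: expectation_ae_eq.
- by apply: measurable_funM => //; exact: Lfun_measurable (hZ j).
- apply: measurable_funM; first exact: Lfun_measurable (X'_second_order i).
  exact: Lfun_measurable (hZ j).
by apply: filterS XX' => t ->.
Qed.

Lemma moment2_aer m (Z : T -> 'cV[R]_m) : second_order P Z ->
  moment2 P Z X = moment2 P Z X'.
Proof. by move=> hZ; rewrite -moment2_tr moment2_ael// moment2_tr. Qed.

Lemma moment2_ae : moment2 P X X = moment2 P X' X'.
Proof. by rewrite moment2_ael ?moment2_aer//; exact: second_order_ae. Qed.

End AlmostEverywhere.
End Bernoulli.

(** * Second moments of the observations *)

Lemma g_sigma_algebraI (T : Type) (G : set_system T) (A B : set T) :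
  <<s G>> A -> <<s G>> B -> <<s G>> (A `&` B).
Proof.
move=> GA GB; rewrite -[A]setCK -[B]setCK -setCU -setTD.
have [_ hC hU] := smallest_sigma_algebra setT G.
apply: (hC); rewrite -bigcup2E; apply: hU => -[|[|i]] /=; rewrite -?setTD.
- exact: (hC).
- exact: (hC).
- by have [] := smallest_sigma_algebra setT G.
Qed.

Lemma g_sigma_algebraT (T : Type) (G : set_system T) : <<s G>> setT.
Proof.
have [h0 hC _] := smallest_sigma_algebra setT G.
by rewrite -[X in _ X]setD0; exact: hC.
Qed.

Section Observations.
Context d (Om : measurableType d) (R : realType) (P : probability Om R).
Context (nx nz p : nat).
Variables (x : nat -> Om -> 'cV[R]_nx) (A B : nat -> 'M[R]_(nx, p)).
Hypothesis x_second_order : forall k, (1 <= k)%N -> second_order P (x k).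
Hypothesis x_zero_mean : forall k, (1 <= k)%N -> mean P (x k) = 0.
Hypothesis x_cov : forall k s, (1 <= s)%N -> (s <= k)%N ->
  Cov P (x k) (x s) = A k *m (B s)^T.
Variables (gam : nat -> {RV P >-> R}) (gbar : nat -> R).
Hypothesis gam_bernoulli : forall k, (1 <= k)%N -> is_bernoulli P (gam k) (gbar k).
Hypothesis gam_indep : mutually_independent P [set k | (1 <= k)%N]
  (fun k => sigma_rv (gam k)).
Variables (v : nat -> Om -> 'cV[R]_nz) (E F : nat -> 'M[R]_nz).
Hypothesis v_second_order : forall k, second_order P (v k).
Hypothesis v_mean : forall k, mean P (v k) = 0.
Hypothesis v_moment2 : forall k s, (1 <= s)%N -> (s <= k)%N ->
  moment2 P (v k) (v s) = E k *m (F s)^T.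
Variables (w : nat -> Om -> 'cV[R]_nz) (Sw : nat -> 'M[R]_nz).
Hypothesis w_white : white_noise P [set k | (1 <= k)%N] w Sw.
Variables (lam : nat -> {RV P >-> R}) (lbar : nat -> R).
Hypothesis lam_bernoulli : forall k, (1 <= k)%N -> is_bernoulli P (lam k) (lbar k).
Hypothesis lam_indep : mutually_independent P [set k | (1 <= k)%N]
  (fun k => sigma_rv (lam k)).
Hypothesis processes_indep : mutually_independent P `I_5
  (nth set0 [:: sigma_vprocess [set k | (1 <= k)%N] x;
                sigma_process [set k | (1 <= k)%N] gam;
                sigma_vprocess [set k | (1 <= k)%N] v;
                sigma_vprocess [set k | (1 <= k)%N] w;
                sigma_process [set k | (1 <= k)%N] lam]).
Variables (H : nat -> 'M[R]_(nz, nx)) (C : nat -> 'cV[R]_nz).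
Variables z y : nat -> Om -> 'cV[R]_nz.
Hypothesis z_eq : forall k t, (1 <= k)%N ->
  z k t = gam k t *: (H k *m x k t + C k) + v k t.
Hypothesis y_eq : forall k t, (1 <= k)%N ->
  y k t = (1 - lam k t) *: z k t + lam k t *: w k t.

(* The positions 0, 1, 2, 3, 4 in this list, standing for x, gam, v, w, lam, are
   the numerals appearing in the applications below. *)
Let procs := [:: sigma_vprocess [set k | (1 <= k)%N] x;
                 sigma_process [set k | (1 <= k)%N] gam;
                 sigma_vprocess [set k | (1 <= k)%N] v;
                 sigma_vprocess [set k | (1 <= k)%N] w;
                 sigma_process [set k | (1 <= k)%N] lam].

Let w_second_order k : (1 <= k)%N -> second_order P (w k).
Proof. by case: w_white => + _ _ _; exact. Qed.

Let w_mean k : (1 <= k)%N -> mean P (w k) = 0.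
Proof. by case: w_white => _ + _ _; exact. Qed.

Let procsT i : `I_5 i -> nth set0 procs i setT.
Proof. by case: i => [|[|[|[|[|//]]]]] _; exact: g_sigma_algebraT. Qed.

Let procs_measurable i : `I_5 i -> nth set0 procs i `<=` measurable.
Proof.
case: i => [|[|[|[|[|//]]]]] _.
- exact: (sigma_vprocess_measurable x_second_order).
- exact: sigma_process_measurable.
- by apply: (@sigma_vprocess_measurable _ _ _ P) => k _.
- exact: (sigma_vprocess_measurable w_second_order).
- exact: sigma_process_measurable.
Qed.

Let mask_indep := moment2_indic_vec_indep processes_indep procsT procs_measurable.
Let mask_same := moment2_indic_vec processes_indep procsT procs_measurable.
Let mask_mean := mean_indic_vec processes_indep procsT procs_measurable.

Let G k := gam k @^-1` [set 1].
Let L k := lam k @^-1` [set 1].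
Let X k := fun t => H k *m x k t + C k.

Let procs_G k : (1 <= k)%N -> nth set0 procs 1 (G k).
Proof. by move=> k1; apply: sigma_process_preimage. Qed.

Let procs_L k : (1 <= k)%N -> nth set0 procs 4 (L k).
Proof. by move=> k1; apply: sigma_process_preimage. Qed.

Let procs_CL k : (1 <= k)%N -> nth set0 procs 4 (~` L k).
Proof.
move=> k1; apply: (@sigma_process_preimage _ _ _ _ lam k (~` [set 1])) => //.
exact: measurableC.
Qed.

Let mG k : measurable (G k). Proof. exact: measurable_funPTI. Qed.
Let mL k : measurable (L k). Proof. exact: measurable_funPTI. Qed.
Let mCL k : measurable (~` L k). Proof. exact: measurableC. Qed.

Let PG k : (1 <= k)%N -> fine (P (G k)) = gbar k.
Proof. by move=> /gam_bernoulli[-> _]. Qed.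

Let PCL k : (1 <= k)%N -> fine (P (~` L k)) = 1 - lbar k.
Proof. by move=> /lam_bernoulli[P1 _]; rewrite probability_setC// P1. Qed.

Let PL k : (1 <= k)%N -> fine (P (L k)) = lbar k.
Proof. by move=> /lam_bernoulli[-> _]. Qed.

Let PGG k j : (1 <= k)%N -> (1 <= j)%N -> k != j ->
  fine (P (G k `&` G j)) = gbar k * gbar j.
Proof.
move=> k1 j1 kj; have := gam_indep (J := [:: k; j]) (A := G).
rewrite /= inE kj bigcap_seq !big_cons !big_nil setIT mule1 => -> //.
  by rewrite fineM ?fin_num_measure// !PG.
by move=> i; rewrite !inE => /orP[] /eqP ->; split=> //; exists [set 1];
  rewrite ?setTI.
Qed.

Let PCLCL k j : (1 <= k)%N -> (1 <= j)%N -> k != j ->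
  fine (P (~` L k `&` ~` L j)) = (1 - lbar k) * (1 - lbar j).
Proof.
move=> k1 j1 kj; have := lam_indep (J := [:: k; j]) (A := fun i => ~` L i).
rewrite /= inE kj bigcap_seq !big_cons !big_nil setIT mule1 => -> //.
  by rewrite fineM ?fin_num_measure// !PCL.
move=> i; rewrite !inE => /orP[] /eqP ->; split=> //; exists (~` [set 1]);
  rewrite ?setTI//; exact: measurableC.
Qed.

Let hX k : (1 <= k)%N -> second_order P (X k).
Proof.
move=> k1; apply: second_orderD; last exact: second_order_cst.
by apply: second_orderM; exact: x_second_order.
Qed.

Let X_mean k : (1 <= k)%N -> mean P (X k) = C k.
Proof.
move=> k1; rewrite meanD; [|by apply: second_orderM; exact: x_second_order
  |exact: second_order_cst].
by rewrite meanM ?x_zero_mean ?mulmx0 ?add0r ?mean_cst//; exact: x_second_order.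
Qed.

Let xX_moment2 k j : (1 <= j)%N -> (j <= k)%N ->
  moment2 P (x k) (X j) = A k *m (B j)^T *m (H j)^T.
Proof.
move=> j1 jk; have k1 := leq_trans j1 jk.
have hx := x_second_order j1.
rewrite moment2Dr//; [|exact: second_orderM|exact: second_order_cst
  |exact: x_second_order].
rewrite moment2Mr//; last exact: x_second_order.
rewrite moment2_cstr; last exact: x_second_order.
by rewrite x_zero_mean// mul0mx addr0 -Cov_zero_mean ?x_zero_mean// x_cov.
Qed.

Let XX_moment2 k j : (1 <= j)%N -> (j <= k)%N ->
  moment2 P (X k) (X j) =
  H k *m A k *m (B j)^T *m (H j)^T + C k *m (C j)^T.
Proof.
move=> j1 jk; have k1 := leq_trans j1 jk.
rewrite moment2Dl; [|by apply: second_orderM; exact: x_second_order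
  |exact: second_order_cst|exact: hX].
rewrite moment2Ml; [|exact: x_second_order|exact: hX].
rewrite moment2_cstl; last exact: hX.
by rewrite X_mean// xX_moment2// !mulmxA.
Qed.

Let Fx k : (1 <= k)%N -> vmeasurable_wrt (nth set0 procs 0) (x k).
Proof. by move=> k1; exact: vmeasurable_wrt_process. Qed.

Let FX k : (1 <= k)%N -> vmeasurable_wrt (nth set0 procs 0) (X k).
Proof. by move=> k1; apply: vmeasurable_wrt_affine; exact: Fx. Qed.

Let Fv k : (1 <= k)%N -> vmeasurable_wrt (nth set0 procs 2) (v k).
Proof. by move=> k1; exact: vmeasurable_wrt_process. Qed.

Let Fw k : (1 <= k)%N -> vmeasurable_wrt (nth set0 procs 3) (w k).
Proof. by move=> k1; exact: vmeasurable_wrt_process. Qed.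

(* Almost surely gam k and lam k are the indicators of G k and L k. *)
Let zm k t := indic_vec (setT `&` G k) (X k) t + indic_vec (setT `&` setT) (v k) t.

(** Each mask is a [lam] event intersected with a [gam] event, [setT] standing for an absent factor,
    so that one set of lemmas handles all pairs of terms. *)
Let ym k t := indic_vec (~` L k `&` G k) (X k) t + indic_vec (~` L k `&` setT) (v k) t
  + indic_vec (L k `&` setT) (w k) t.

Let z_ae k : (1 <= k)%N -> \forall t \ae P, z k t = zm k t.
Proof.
move=> k1; apply: filterS (bernoulli_indic (gam_bernoulli k1)) => t gt.
by rewrite z_eq// gt /zm /indic_vec !setTI indicT scale1r.
Qed.

Let y_ae k : (1 <= k)%N -> \forall t \ae P, y k t = ym k t.
Proof.
move=> k1; apply: filterS2 (bernoulli_indic (gam_bernoulli k1))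
  (bernoulli_indic (lam_bernoulli k1)) => t gt lt.
rewrite y_eq// z_eq// gt lt /ym /indic_vec !setIT indicI /= -/(G k) -/(L k).
rewrite scalerDr scalerA; congr (_ *: _ + _ *: _ + _).
  by rewrite !indicE in_setC; case: (t \in L k); rewrite ?subrr ?subr0.
by rewrite !indicE in_setC; case: (t \in L k); rewrite ?subrr ?subr0.
Qed.

Let FI4 U V : nth set0 procs 4 U -> nth set0 procs 4 V ->
  nth set0 procs 4 (U `&` V).
Proof. exact: g_sigma_algebraI. Qed.

Let FI1 U V : nth set0 procs 1 U -> nth set0 procs 1 V ->
  nth set0 procs 1 (U `&` V).
Proof. exact: g_sigma_algebraI. Qed.

Let T4 : nth set0 procs 4 setT. Proof. exact: procsT. Qed.
Let T1 : nth set0 procs 1 setT. Proof. exact: procsT. Qed.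

(** * Moments of pairs of masked vectors *)

Section Pairs.
Variables (a b : nat) (m n : nat) (V : Om -> 'cV[R]_m) (W : Om -> 'cV[R]_n).
Hypothesis V_second_order : second_order P V.
Hypothesis W_second_order : second_order P W.
Variables U U' S S' : set Om.
Hypotheses (hU : nth set0 procs 4 U) (hU' : nth set0 procs 4 U').
Hypotheses (hS : nth set0 procs 1 S) (hS' : nth set0 procs 1 S').
Hypothesis FV : vmeasurable_wrt (nth set0 procs a) V.

Let indic_cross : vmeasurable_wrt (nth set0 procs b) W ->
  uniq [:: 4; 1; a; b]%N -> (a < 5)%N -> (b < 5)%N ->
  moment2 P (indic_vec (U `&` S) V) (indic_vec (U' `&` S') W) =
  (fine (P (U `&` U')) * fine (P (S `&` S'))) *: (mean P V *m (mean P W)^T).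
Proof.
move=> FW ab a5 b5.
by apply: (mask_indep ab) => //; [exact: FI4|exact: FI1].
Qed.

Lemma indic_cross_r : vmeasurable_wrt (nth set0 procs b) W ->
  uniq [:: 4; 1; a; b]%N -> (a < 5)%N -> (b < 5)%N -> mean P W = 0 ->
  moment2 P (indic_vec (U `&` S) V) (indic_vec (U' `&` S') W) = 0.
Proof. by move=> FW ab a5 b5 W0; rewrite indic_cross// W0 trmx0 mulmx0 scaler0. Qed.

Lemma indic_cross_l : vmeasurable_wrt (nth set0 procs b) W ->
  uniq [:: 4; 1; a; b]%N -> (a < 5)%N -> (b < 5)%N -> mean P V = 0 ->
  moment2 P (indic_vec (U `&` S) V) (indic_vec (U' `&` S') W) = 0.
Proof. by move=> FW ab a5 b5 V0; rewrite indic_cross// V0 mul0mx scaler0. Qed.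

Lemma indic_same : vmeasurable_wrt (nth set0 procs a) W ->
  a \in [:: 0; 2; 3]%N ->
  moment2 P (indic_vec (U `&` S) V) (indic_vec (U' `&` S') W) =
  (fine (P (U `&` U')) * fine (P (S `&` S'))) *: moment2 P V W.
Proof.
(* The fourth process has no part in the formula; [b'] is merely a vector process different from
   [a]. *)
move=> FW a023; pose b' := if a == 0%N then 2%N else 0%N.
have ab : uniq [:: 4; 1; a; b']%N.
  by move: a023; rewrite /b' !inE => /or3P[] /eqP ->.
have a5 : (a < 5)%N by move: a023; rewrite !inE => /or3P[] /eqP ->.
have b5 : (b' < 5)%N by rewrite /b'; case: ifP.
apply: (mask_same ab) => //; [exact: FI4|exact: FI1|] => i j.
move: FV FW; move: a023; rewrite !inE => /or3P[] /eqP -> hV hW;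
  exact: measurable_wrtM.
Qed.

Lemma indic_mean : a \in [:: 0; 2; 3]%N ->
  mean P (indic_vec (U `&` S) V) = (fine (P U) * fine (P S)) *: mean P V.
Proof.
move=> a023; pose b' := if a == 0%N then 2%N else 0%N.
have ab : uniq [:: 4; 1; a; b']%N.
  by move: a023; rewrite /b' !inE => /or3P[] /eqP ->.
have a5 : (a < 5)%N by move: a023; rewrite !inE => /or3P[] /eqP ->.
have b5 : (b' < 5)%N by rewrite /b'; case: ifP.
exact: (mask_mean ab).
Qed.

End Pairs.

Let hiX U S k : measurable U -> measurable S -> (1 <= k)%N ->
  second_order P (indic_vec (U `&` S) (X k)).
Proof.
by move=> mU mS k1; apply: second_order_indic_vec (hX k1); exact: measurableI.
Qed.

Let hiv U S k : measurable U -> measurable S ->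
  second_order P (indic_vec (U `&` S) (v k)).
Proof.
by move=> mU mS; apply: second_order_indic_vec (v_second_order k);
  exact: measurableI.
Qed.

Let hiw U S k : measurable U -> measurable S -> (1 <= k)%N ->
  second_order P (indic_vec (U `&` S) (w k)).
Proof.
by move=> mU mS k1; apply: second_order_indic_vec (w_second_order k1);
  exact: measurableI.
Qed.

Let hzm k : (1 <= k)%N -> second_order P (zm k).
Proof. by move=> k1; apply: second_orderD; [exact: hiX|exact: hiv]. Qed.

Let hym k : (1 <= k)%N -> second_order P (ym k).
Proof.
move=> k1; apply: second_orderD; last exact: hiw.
by apply: second_orderD; [exact: hiX|exact: hiv].
Qed.

Let z_measurable k i : (1 <= k)%N -> measurable_fun setT (fun t => z k t i 0).
Proof.
move=> k1; under eq_fun do rewrite z_eq// mxE [X in X + _]mxE.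
apply: measurable_funD; last exact: Lfun_measurable (v_second_order k i).
by apply: measurable_funM => //; exact: Lfun_measurable (hX k1 i).
Qed.

Let y_measurable k i : (1 <= k)%N -> measurable_fun setT (fun t => y k t i 0).
Proof.
move=> k1; under eq_fun do rewrite y_eq// mxE [X in X + _]mxE [X in _ + X]mxE.
apply: measurable_funD; apply: measurable_funM => //.
- exact: measurable_funB.
- exact: z_measurable.
- exact: Lfun_measurable (w_second_order k1 i).
Qed.

Lemma y_second_order k : (1 <= k)%N -> second_order P (y k).
Proof.
move=> k1; apply: (second_order_ae _ (hym k1) (y_ae k1)) => i.
exact: y_measurable.
Qed.

Lemma y_mean k : (1 <= k)%N -> mean P (y k) = (1 - lbar k) *: (gbar k *: C k).
Proof.
move=> k1; rewrite (mean_ae (fun i => y_measurable i k1) (hym k1) (y_ae k1)).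
rewrite meanD; [|by apply: second_orderD; [exact: hiX|exact: hiv]|exact: hiw].
rewrite meanD; [|exact: hiX|exact: hiv].
rewrite (indic_mean (a := 0) (hX k1) (procs_CL k1) (procs_G k1) (FX k1))//.
rewrite (indic_mean (a := 2) (v_second_order k) (procs_CL k1) T1 (Fv k1))//.
rewrite (indic_mean (a := 3) (w_second_order k1) (procs_L k1) T1 (Fw k1))//.
by rewrite v_mean w_mean// !scaler0 !addr0 PCL// PG// scalerA X_mean.
Qed.

Lemma xy_moment2 k j : (1 <= j)%N -> (j <= k)%N -> moment2 P (x k) (y j) =
  (1 - lbar j) *: (gbar j *: (A k *m (B j)^T *m (H j)^T)).
Proof.
move=> j1 jk; have k1 := leq_trans j1 jk; have hx := x_second_order k1.
rewrite (moment2_aer (fun i => y_measurable i j1) (hym j1) (y_ae j1))//.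
rewrite moment2Dr//; [|by apply: second_orderD; [exact: hiX|exact: hiv]|exact: hiw].
rewrite moment2Dr//; [|exact: hiX|exact: hiv].
(* A trivial mask brings the signal into the form required for pairs. *)
have -> : x k = indic_vec (setT `&` setT) (x k).
  by apply/funext => t; rewrite /indic_vec setIT indicT scale1r.
rewrite (indic_same (a := 0) hx (hX j1) T4 (procs_CL j1) T1 (procs_G j1) (Fx k1)
  (FX j1))//.
rewrite (indic_cross_r (a := 0) (b := 2) hx (v_second_order j) T4 (procs_CL j1)
  T1 T1 (Fx k1) (Fv j1))//.
rewrite (indic_cross_r (a := 0) (b := 3) hx (w_second_order j1) T4 (procs_L j1)
  T1 T1 (Fx k1) (Fw j1)) ?w_mean//.
by rewrite !addr0 !setTI PCL// PG// xX_moment2// scalerA.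
Qed.

(** The factor [gbar k] is not squared because [G k] meets itself in [G k]; the cross terms vanish
    with the mean of [v k]. *)
Lemma z_moment2 k : (1 <= k)%N -> moment2 P (z k) (z k) =
  gbar k *: (H k *m A k *m (B k)^T *m (H k)^T + C k *m (C k)^T)
  + E k *m (F k)^T.
Proof.
move=> k1; rewrite (moment2_ae (fun i => z_measurable i k1) (hzm k1) (z_ae k1)).
have hv := v_second_order k; have hXk := hX k1.
have hzk := hzm k1; have hiXk := hiX measurableT (mG k) k1.
have hivk := hiv k measurableT measurableT.
rewrite moment2Dl// moment2Dr// moment2Dr//.
rewrite (indic_same (a := 0) hXk hXk T4 T4 (procs_G k1) (procs_G k1) (FX k1))//;
  last exact: FX.
rewrite (indic_same (a := 2) hv hv T4 T4 T1 T1 (Fv k1))//; last exact: Fv.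
rewrite (indic_cross_r (a := 0) (b := 2) hXk hv T4 T4 (procs_G k1) T1 (FX k1)
  (Fv k1))//.
rewrite (indic_cross_l (a := 2) (b := 0) hv hXk T4 T4 T1 (procs_G k1) (Fv k1)
  (FX k1))//.
rewrite !setIid probability_setT /= !mul1r scale1r PG// addr0 add0r.
by rewrite XX_moment2// v_moment2.
Qed.

(** The joint probabilities are left unevaluated to serve two cases: for [k = j] the masks are
    idempotent, while for [k != j] they are independent and whiteness removes the term in [w]. *)
Let ym_moment2 k j : (1 <= k)%N -> (1 <= j)%N -> moment2 P (y k) (y j) =
  (fine (P (~` L k `&` ~` L j)) * fine (P (G k `&` G j))) *: moment2 P (X k) (X j)
  + fine (P (~` L k `&` ~` L j)) *: moment2 P (v k) (v j)
  + fine (P (L k `&` L j)) *: moment2 P (w k) (w j).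
Proof.
move=> k1 j1.
rewrite (moment2_ael (fun i => y_measurable i k1) (hym k1) (y_ae k1)); last first.
  exact: y_second_order.
rewrite (moment2_aer (fun i => y_measurable i j1) (hym j1) (y_ae j1) (hym k1)).
have hv i := v_second_order i; have hXk := hX k1; have hXj := hX j1.
have hwk := w_second_order k1; have hwj := w_second_order j1.
have hyj := hym j1; have hiXk := hiX (mCL k) (mG k) k1.
have hivk := hiv k (mCL k) measurableT; have hiwk := hiw (mL k) measurableT k1.
have hiXj := hiX (mCL j) (mG j) j1.
have hivj := hiv j (mCL j) measurableT; have hiwj := hiw (mL j) measurableT j1.
have hXvk := second_orderD hiXk hivk; have hXvj := second_orderD hiXj hivj.
(* [X k] and [X j] are themselves sums; naming their moment shields it from the expansion. *)
set MX := moment2 P (X k) (X j); rewrite !moment2Dl// !moment2Dr//.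
have [Ck Cj] := (procs_CL k1, procs_CL j1).
have [Lk Lj] := (procs_L k1, procs_L j1).
have [Gk Gj] := (procs_G k1, procs_G j1).
rewrite (indic_same (a := 0) hXk hXj Ck Cj Gk Gj (FX k1) (FX j1))// -/MX.
rewrite (indic_same (a := 2) (hv k) (hv j) Ck Cj T1 T1 (Fv k1) (Fv j1))//.
rewrite (indic_same (a := 3) hwk hwj Lk Lj T1 T1 (Fw k1) (Fw j1))//.
rewrite (indic_cross_r (a := 0) (b := 2) hXk (hv j) Ck Cj Gk T1 (FX k1) (Fv j1))//.
rewrite (indic_cross_l (a := 2) (b := 0) (hv k) hXj Ck Cj T1 Gj (Fv k1) (FX j1))//.
rewrite (indic_cross_r (a := 0) (b := 3) hXk hwj Ck Lj Gk T1 (FX k1) (Fw j1))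
  ?w_mean//.
rewrite (indic_cross_l (a := 3) (b := 0) hwk hXj Lk Cj T1 Gj (Fw k1) (FX j1))
  ?w_mean//.
rewrite (indic_cross_r (a := 2) (b := 3) (hv k) hwj Ck Lj T1 T1 (Fv k1) (Fw j1))
  ?w_mean//.
rewrite (indic_cross_l (a := 3) (b := 2) hwk (hv j) Lk Cj T1 T1 (Fw k1) (Fv j1))
  ?w_mean//.
by rewrite setIT probability_setT !mulr1 !addr0 !add0r.
Qed.

Lemma y_moment2_diag k : (1 <= k)%N -> moment2 P (y k) (y k) =
  (1 - lbar k) *: moment2 P (z k) (z k) + lbar k *: Sw k.
Proof.
move=> k1; case: w_white => _ _ Cw _.
rewrite ym_moment2// !setIid PCL// PG// PL// -Cw//.
rewrite Cov_zero_mean ?w_mean// z_moment2// -XX_moment2// v_moment2//.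
by rewrite scalerDr scalerA.
Qed.

Lemma y_moment2 k j : (1 <= j < k)%N -> moment2 P (y k) (y j) =
  ((1 - lbar k) * (1 - lbar j)) *: ((gbar k * gbar j) *:
    (H k *m A k *m (B j)^T *m (H j)^T + C k *m (C j)^T) + E k *m (F j)^T).
Proof.
move=> /andP[j1 jk]; have k1 := ltn_trans j1 jk.
have kj : k != j by rewrite gtn_eqF.
case: w_white => _ _ _ Cw.
rewrite ym_moment2// PCLCL// PGG//.
rewrite -[moment2 P (w k) _]Cov_zero_mean ?w_mean// Cw// scaler0 addr0.
by rewrite -XX_moment2 ?(ltnW jk)// v_moment2 ?(ltnW jk)// scalerDr scalerA.
Qed.

End Observations.

(** * The observation model as an instance of the abstract recursion *)

Theorem theorem3p1 (R : realType) (d : measure_display) (Om : measurableType d)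
  (P : probability Om R) (nx nz p : nat)
  (* signal *)
  (x : nat -> Om -> 'cV[R]_nx) (A B : nat -> 'M[R]_(nx, p))
  (x_second_order : forall k, (1 <= k)%N -> second_order P (x k))
  (x_zero_mean : forall k, (1 <= k)%N -> mean P (x k) = 0)
  (x_cov : forall k s, (1 <= s)%N -> (s <= k)%N ->
     Cov P (x k) (x s) = A k *m (B s)^T)
  (* multiplicative noise *)
  (gam : nat -> {RV P >-> R}) (gbar : nat -> R)
  (gam_bernoulli : forall k, (1 <= k)%N -> is_bernoulli P (gam k) (gbar k))
  (gam_indep : mutually_independent P [set k | (1 <= k)%N]
     (fun k => sigma_rv (gam k)))
  (* measurement functions *)
  (h : nat -> 'cV[R]_nx -> 'cV[R]_nz)
  (h_analytic : forall k, (1 <= k)%N -> analytic (h k))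
  (* time-correlated additive noise *)
  (v u : nat -> Om -> 'cV[R]_nz) (D Su Sv E F : nat -> 'M[R]_nz)
  (v0_second_order : second_order P (v 0%N))
  (v0_zero_mean : mean P (v 0%N) = 0)
  (v0_cov : Cov P (v 0%N) (v 0%N) = Sv 0%N)
  (D_nonsingular : forall k, D k \in unitmx)
  (v_eq : forall k t, (1 <= k)%N -> v k t = D k.-1 *m v k.-1 t + u k.-1 t)
  (u_white : white_noise P setT u Su)
  (u_v0_indep : mutually_independent P `I_2
     (nth set0 [:: sigma_vprocess setT u; sigma_vprocess [set 0%N] v]))
  (Sv_eq : forall s, (1 <= s)%N ->
     Sv s = D s.-1 *m Sv s.-1 *m (D s.-1)^T + Su s.-1)
  (E_0 : E 0%N = 1%:M)
  (E_eq : forall k, (1 <= k)%N -> E k = D k.-1 *m E k.-1)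
  (F_eq : forall s, (1 <= s)%N -> F s = Sv s *m (invmx (E s))^T)
  (* noise replacing the measurement, and the random variables selecting it *)
  (w : nat -> Om -> 'cV[R]_nz) (Sw : nat -> 'M[R]_nz)
  (w_white : white_noise P [set k | (1 <= k)%N] w Sw)
  (lam : nat -> {RV P >-> R}) (lbar : nat -> R)
  (lam_bernoulli : forall k, (1 <= k)%N -> is_bernoulli P (lam k) (lbar k))
  (lam_indep : mutually_independent P [set k | (1 <= k)%N]
     (fun k => sigma_rv (lam k)))
  (processes_indep : mutually_independent P `I_5
     (nth set0 [:: sigma_vprocess [set k | (1 <= k)%N] x;
                   sigma_process [set k | (1 <= k)%N] gam;
                   sigma_vprocess [set k | (1 <= k)%N] v;
                   sigma_vprocess [set k | (1 <= k)%N] w;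
                   sigma_process [set k | (1 <= k)%N] lam]))
  (* the nonlinear observation model *)
  (znl ynl : nat -> Om -> 'cV[R]_nz)
  (znl_eq : forall k t, (1 <= k)%N ->
     znl k t = gam k t *: h k (x k t) + v k t)
  (ynl_eq : forall k t, (1 <= k)%N ->
     ynl k t = (1 - lam k t) *: znl k t + lam k t *: w k t)
  (* its linear approximation about the nominal trajectory x0 *)
  (x0 : nat -> 'cV[R]_nx) (H : nat -> 'M[R]_(nz, nx)) (C : nat -> 'cV[R]_nz)
  (H_eq : forall k, (1 <= k)%N -> H k = jacobian_mx (h k) (x0 k))
  (C_eq : forall k, (1 <= k)%N -> C k = h k (x0 k) - H k *m x0 k)
  (z y : nat -> Om -> 'cV[R]_nz)
  (z_eq : forall k t, (1 <= k)%N ->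
     z k t = gam k t *: (H k *m x k t + C k) + v k t)
  (y_eq : forall k t, (1 <= k)%N ->
     y k t = (1 - lam k t) *: z k t + lam k t *: w k t)
  (* auxiliary matrices *)
  (Gam Del : forall a : component, nat -> 'M[R]_(nz, cdim p nz a))
  (Gam_x : forall k, (1 <= k)%N -> Gam Signal k = gbar k *: (H k *m B k))
  (Gam_v : forall k, (1 <= k)%N -> Gam Noise k = F k)
  (Del_x : forall k, (1 <= k)%N -> Del Signal k = gbar k *: (H k *m A k))
  (Del_v : forall k, (1 <= k)%N -> Del Noise k = E k)
  (* one-stage predictors of the observations, innovations, filters: functions
     of the data record, optimal under the linear approximation *)
  (yhat eta : nat -> (nat -> 'cV[R]_nz) -> 'cV[R]_nz)
  (xhat : nat -> (nat -> 'cV[R]_nz) -> 'cV[R]_nx)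
  (Seta : nat -> 'M[R]_nz)
  (yhat_LS : forall k, (1 <= k)%N ->
     LS_linear_estimator P y k.-1 (y k) (yhat k))
  (eta_eq : forall k Y, (1 <= k)%N -> eta k Y = Y k - yhat k Y)
  (Seta_eq : forall k, (1 <= k)%N ->
     Seta k = Cov P (fun t => eta k (y ^~ t)) (fun t => eta k (y ^~ t)))
  (Seta_nonsingular : forall k, (1 <= k)%N -> Seta k \in unitmx)
  (xhat_LS : forall k, (1 <= k)%N -> LS_linear_estimator P y k (x k) (xhat k)) :
  exists (e : forall a : component,
                nat -> (nat -> 'cV[R]_nz) -> 'cV[R]_(cdim p nz a))
         (Psi : forall a : component, nat -> 'M[R]_(cdim p nz a, nz))
         (T : forall a b : component,
                nat -> 'M[R]_(cdim p nz a, cdim p nz b)),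
    (* the data record Y is arbitrary: it may be a path of y, but also a path of
       the nonlinear observations ynl *)
    (forall k Y, (1 <= k)%N ->
       eta k Y = Y k - (1 - lbar k) *:
         (Del Signal k *m e Signal k.-1 Y + Del Noise k *m e Noise k.-1 Y
          + gbar k *: C k)) /\
    (* the paper's Sigma^y_k and Sigma^z_k are non-centred second moments *)
    (forall k, (1 <= k)%N ->
       Seta k = moment2 P (y k) (y k) - (1 - lbar k) ^+ 2 *:
         ((Del Signal k *m T Signal Signal k.-1
             + Del Noise k *m T Noise Signal k.-1) *m (Del Signal k)^T
          + (Del Signal k *m T Signal Noise k.-1
             + Del Noise k *m T Noise Noise k.-1) *m (Del Noise k)^T
          + gbar k ^+ 2 *: (C k *m (C k)^T))) /\
    (forall k, (1 <= k)%N ->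
       moment2 P (y k) (y k)
       = (1 - lbar k) *: moment2 P (z k) (z k) + lbar k *: Sw k) /\
    (forall k, (1 <= k)%N ->
       moment2 P (z k) (z k)
       = gbar k *: (H k *m A k *m (B k)^T *m (H k)^T + C k *m (C k)^T)
         + E k *m (F k)^T) /\
    (forall a Y, e a 0%N Y = 0) /\
    (forall a k Y, (1 <= k)%N ->
       e a k Y = e a k.-1 Y + Psi a k *m invmx (Seta k) *m eta k Y) /\
    (forall a k, (1 <= k)%N ->
       Psi a k = (1 - lbar k) *:
         (Gam a k - Del Signal k *m T Signal a k.-1
                  - Del Noise k *m T Noise a k.-1)^T) /\
    (forall a b k,
       T a b k = moment2 P (fun t => e a k (y ^~ t)) (fun t => e b k (y ^~ t))) /\
    (forall a b, T a b 0%N = 0) /\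
    (forall a b k, (1 <= k)%N ->
       T a b k = T a b k.-1 + Psi a k *m invmx (Seta k) *m (Psi b k)^T) /\
    (forall k Y, (1 <= k)%N -> xhat k Y = A k *m e Signal k Y).
Proof.
have trZ m n a (M : 'M[R]_(m, n)) : (a *: M)^T = a *: M^T by exact: linearZ.
have hv := noise_second_order v0_second_order v_eq u_white.
have v0 := noise_mean v0_second_order v0_zero_mean v_eq u_white.
have vv := noise_moment2 v0_second_order v0_zero_mean v0_cov D_nonsingular v_eq
  u_white u_v0_indep Sv_eq E_0 E_eq F_eq.
have hy := y_second_order x_second_order gam_bernoulli hv w_white lam_bernoulli
  z_eq y_eq.
have y0 := y_mean x_second_order x_zero_mean gam_bernoulli hv v0 w_white
  lam_bernoulli processes_indep z_eq y_eq.
have xy := xy_moment2 x_second_order x_zero_mean x_cov gam_bernoulli hv v0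
  w_white lam_bernoulli processes_indep z_eq y_eq.
have zz := z_moment2 x_second_order x_zero_mean x_cov gam_bernoulli hv v0 vv
  w_white processes_indep z_eq.
have yy := y_moment2_diag x_second_order x_zero_mean x_cov gam_bernoulli hv v0 vv
  w_white lam_bernoulli processes_indep z_eq y_eq.
have yyj := y_moment2 x_second_order x_zero_mean x_cov gam_bernoulli gam_indep hv
  v0 vv w_white lam_bernoulli lam_indep processes_indep z_eq y_eq.
(* [L k] is the expected weight of [z k] in [y k], and [mu k] is the mean of [z k]. The factors
   [gbar k] and [gbar j] of the cross moments are absorbed in [Del Signal k] and [Gam Signal j]. *)
pose L k := 1 - lbar k; pose mu k := gbar k *: C k.
have core_moment k j : (1 <= j < k)%N ->
    moment2 P (y k) (y j) = L j *: (L k *: Del Signal k *m (Gam Signal j)^T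
      + L k *: Del Noise k *m (Gam Noise j)^T + (L k *: mu k) *m (mu j)^T).
  move=> /[dup] jk /andP[j1 /(ltn_trans j1) k1].
  rewrite yyj// Del_x// Del_v// Gam_x// Gam_v// /L /mu.
  rewrite !trZ trmx_mul -!scalemxAl -!scalemxAr !mulmxA.
  move: (H k *m _ *m _ *m _) (C k *m _) (E k *m _) => M1 M2 M3.
  by apply/matrixP => a b; rewrite !mxE; ring.
have [S_Cov S_unit] := (Seta_eq, Seta_nonsingular).
have innov k := innovations hy y0 core_moment yhat_LS eta_eq S_Cov S_unit k.
exists (evec eta Seta L Gam Del), (Psi Seta L Gam Del),
  (fun a b k => Tcov Seta L Gam Del k a b).
(* The formula for [Psi] and the zero initial value of [T] hold by computation, so [split] already
   closes them. *)
do !split.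
- move=> k Y k1; rewrite eta_eq//; congr (_ - _).
  by have [_ ->] := innov k; rewrite ?k1 /=.
- move=> k k1.
  rewrite [LHS](innovation_covariance hy y0 core_moment yhat_LS eta_eq S_Cov S_unit k1).
  by rewrite /mu trZ -scalemxAl -scalemxAr scalerA -expr2.
- exact: yy.
- exact: zz.
- by move=> a Y; exact: evec0.
- by move=> a [//|k] Y _; exact: evecS.
- move=> a b k; have [hS _] := innov k.
  by rewrite (moment2_evec L Gam Del hy yhat_LS eta_eq S_Cov S_unit).
- by move=> a b [//|k] _; exact: TcovS.
- move=> k Y k1; have [hS hk] := innov k.
  (* The additive noise has zero mean and is independent of the signal, so [x k] has no component
     along the noise vector. *)
  pose U a : 'M[R]_(nx, cdim p nz a) :=
    match a with Signal => A k | Noise => 0 end.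
  rewrite (LS_linear_estimatorE hy yhat_LS eta_eq S_Cov S_unit (U := U)
    (x_second_order k k1) (x_zero_mean k k1) _ hk hS (xhat_LS k k1)).
    by rewrite /= add0r mul0mx addr0.
  move=> j /andP[j1 jk]; rewrite xy// Gam_x// /U !mul0mx !addr0.
  by rewrite trZ -scalemxAr trmx_mul mulmxA.
Qed.
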